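(* Let $n\geqslant4$, let $a_3,\ldots,a_{n-1}\in\mathbb{C}$ be not all zero, and let $\mathfrak{s}_{3,n+1}^{a_3,\ldots,a_{n-1}}$ be the $(n+1)$-dimensional complex Lie algebra with basis $e_1,\ldots,e_{n+1}$ and non-zero commutation relations \[ [e_k,e_n]=e_{k-1},\ k=2,\ldots,n-1,\qquad [e_k,e_{n+1}]=e_k+\sum_{i=1}^{k-2}a_{k-i+1}e_i,\ k=1,\ldots,n-1. \] Put $\xi_1=e_1$, $\xi_2=0$, $\xi_k=\sum_{j=1}^k\frac{(-1)^{k-j}}{(k-j)!}e_1^{j-2}e_2^{k-j}e_j$ for $k=3,\ldots,n-1$, and \[ b_{mi}=\sum_{\substack{3\leqslant s_1,\ldots,s_i\leqslant n-1\\ s_1+\cdots+s_i=m+i}}a_{s_1}\cdots a_{s_i}. \] Then, for any values of the parameters, $\mathfrak{s}_{3,n+1}^{a_3,\ldots,a_{n-1}}$ has $n-3$ independent invariants, and a complete set of generalized Casimir operators (a basis of $\mathrm{Inv}(\mathfrak{s}_{3,n+1}^{a_3,\ldots,a_{n-1}})$) is formed by the expressions \[ \xi_1^{-k+1}\xi_k+\sum_{m=2}^{k-1}\xi_1^{-k+m+1}\xi_{k-m}\sum_{i=1}^{\left[\frac m2\right]}\frac{b_{mi}}{i!}(-\ln\xi_1)^i,\qquad k=3,\ldots,n-1. \]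
   Context: $\left[\frac m2\right]$ denotes the integer part of $m/2$. For a finite-dimensional complex Lie algebra $\mathfrak{g}$ with basis $e_1,\ldots,e_N$, $[e_i,e_j]=c_{ij}^ke_k$, let $x_1,\ldots,x_N$ be the coordinates on $\mathfrak{g}^*$ associated with the dual basis. An invariant of the coadjoint action is a (possibly only locally defined) function $F(x_1,\ldots,x_N)$ invariant under the coadjoint action; such a function satisfies $\sum_{j,k}c_{ij}^kx_k\,\partial F/\partial x_j=0$ for all $i$. The maximal number of functionally independent invariants is $N_\mathfrak{g}=\dim\mathfrak{g}-\sup_x\operatorname{rank}(\sum_k c_{ij}^kx_k)_{i,j}$. A basis (complete set) of invariants is a set of $N_\mathfrak{g}$ functionally independent invariants. Elements of $\mathrm{Inv}(\mathfrak{g})$ (generalized Casimir operators) are obtained from invariants by replacing $x_i$ by $e_i$ (with symmetrization of non-commuting products); here only the mutually commuting elements $e_1,\ldots,e_{n-1}$ occur, so the symmetrization is trivial and $e_i$ may be read as the coordinate $x_i$. $\ln$ is understood as a local branch.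
   Formalization: In the summand m=k-1 the factor ξ_1^{-k+m+1}ξ_{k-m}, literally ξ_1^0ξ_1=e_1, is replaced by 1 (the value of the sum formula for ξ_k at k=1); with e_1 the expression is not invariant, e.g. n=4, k=3, a_3≠0. *)

(* Defs.v *)
From HB Require Import structures.
From mathcomp Require Import all_boot all_order all_algebra.
From mathcomp Require Import complex zify ring.
From mathcomp Require Import all_classical all_reals all_analysis.

Set Implicit Arguments.
Unset Strict Implicit.
Unset Printing Implicit Defensive.

Import Order.TTheory GRing.Theory Num.Theory numFieldNormedType.Exports.

Local Open Scope classical_set_scope.
Local Open Scope ring_scope.

(* R[i] itself carries no canonical topology; packing it as a                 *)
(* numClosedFieldType gives it, and matrices over it, the usual normed one.   *)
Definition cplx (R : realType) : numClosedFieldType := R[i].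

Definition cexp (R : realType) (z : cplx R) : cplx R :=
  (Complex (expR (complex.Re z) * cos (complex.Im z))
           (expR (complex.Re z) * sin (complex.Im z)))%C.

(* Since cexp never vanishes, 0 cannot lie in D. *)
Definition log_branch (R : realType) (D : set (cplx R)) (L : cplx R -> cplx R)
    : Prop :=
  [/\ open D,
      forall z, D z -> {for z, continuous L}
    & forall z, D z -> cexp (L z) = z].

(* A Lie algebra of dimension N with a fixed basis e_i (i : 'I_N):            *)
(* [e_i, e_j] = \sum_k sc i j k * e_k.                                        *)
Record lie_algebra (K : fieldType) (N : nat) := LieAlgebra {
  sc : 'I_N -> 'I_N -> 'I_N -> K;
  sc_alt : forall i k, sc i i k = 0;
  sc_anti : forall i j k, sc i j k = - sc j i k;
  sc_jacobi : forall i j k l,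
    \sum_m (sc i j m * sc m k l + sc j k m * sc m i l + sc k i m * sc m j l)
      = 0
}.

(* N_g = dim g - sup_x rank (\sum_k c_ij^k x_k)_(i, j) *)
Definition commutator_mx (K : fieldType) (N : nat) (g : lie_algebra K N)
    (x : 'rV[K]_N) : 'M[K]_N :=
  \matrix_(i, j) \sum_k sc g i j k * x 0 k.

Definition sup_rank (K : fieldType) (N : nat) (g : lie_algebra K N) : nat :=
  (\max_(r < N.+1 | `[< exists x, \rank (commutator_mx g x) = r >]) r)%N.

Definition num_invariants (K : fieldType) (N : nat) (g : lie_algebra K N)
    : nat :=
  (N - sup_rank g)%N.

(* A point of the dual g^* is the row vector x of its coordinates             *)
(* x_k = x(e_k).  For u = \sum_i u_i e_i, right multiplication by coad_mx g u *)
(* is ad^*_u, i.e. (ad^*_u x)(e_j) = - x([u, e_j]).                           *)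
Definition coad_mx (K : fieldType) (N : nat) (g : lie_algebra K N)
    (u : 'rV[K]_N) : 'M[K]_N :=
  \matrix_(k, j) - \sum_i u 0 i * sc g i j k.

Definition exp_mx (R : realType) (N : nat) (A : 'M[cplx R]_N)
    : 'M[cplx R]_N :=
  lim (series (fun k : nat => (k`!%:R)^-1 *: A ^+ k) @ \oo).

(* Ad^*_(exp u) = exp (ad^*_u) *)
Definition coadjoint_exp (R : realType) (N : nat) (g : lie_algebra (cplx R) N)
    (u x : 'rV[cplx R]_N) : 'rV[cplx R]_N :=
  x *m exp_mx (coad_mx g u).

(* Invariants on an open set U: holomorphic functions fixed by the coadjoint  *)
(* action of all group elements exp u close to the identity.  The             *)
(* neighbourhood of u = 0 depends on the point x, since a locally defined     *)
(* function (e.g. involving a branch of the logarithm) need not be fixed by   *)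
(* group elements that move x far away.                                       *)
Definition coadjoint_invariant (R : realType) (N : nat)
    (g : lie_algebra (cplx R) N) (U : set 'rV[cplx R]_N)
    (F : 'rV[cplx R]_N -> cplx R) : Prop :=
  [/\ open U,
      forall x, U x -> differentiable F x
    & forall x, U x ->
        \forall u \near (0 : 'rV[cplx R]_N), F (coadjoint_exp g u x) = F x].

(* F_1, ..., F_r are functionally independent on U when on no nonempty open   *)
(* part V of U they satisfy a relation Phi (F_1, ..., F_r) = 0 with Phi       *)
(* nontrivial, that is, not identically zero on any nonempty open set.        *)
Definition functionally_independent (R : realType) (N r : nat)
    (U : set 'rV[cplx R]_N) (F : 'I_r -> 'rV[cplx R]_N -> cplx R) : Prop :=
  forall V : set 'rV[cplx R]_N, open V -> V !=set0 -> V `<=` U ->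
  forall Phi : 'rV[cplx R]_r -> cplx R, continuous Phi ->
    (forall x, V x -> Phi (\row_k F k x) = 0) ->
    exists W : set 'rV[cplx R]_r,
      [/\ open W, W !=set0 & forall y, W y -> Phi y = 0].

Definition invariant_basis (R : realType) (N r : nat)
    (g : lie_algebra (cplx R) N) (U : set 'rV[cplx R]_N)
    (F : 'I_r -> 'rV[cplx R]_N -> cplx R) : Prop :=
  [/\ r = num_invariants g,
      forall k, coadjoint_invariant g U (F k)
    & functionally_independent U F].

(* Below, p, q, r are labels from 1 to n + 1, the basis vector with label p   *)
(* having index p - 1 in 'I_n.+1.                                             *)

(* The coefficient of e_r in [e_p, e_q] in the commutation relations as they  *)
(* are listed; 0 if [e_p, e_q] is not listed.                                 *)
Definition s3_rel (K : fieldType) (n : nat) (a : nat -> K) (p q r : nat) : K :=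
  if (q == n) && (2 <= p <= n.-1)%N then (r == p.-1)%:R
  else if (q == n.+1) && (1 <= p <= n.-1)%N then
    (r == p)%:R + (if (1 <= r <= p - 2)%N then a (p - r + 1)%N else 0)
  else 0.

Definition s3_sc (K : fieldType) (n : nat) (a : nat -> K)
    (i j k : 'I_n.+1) : K :=
  s3_rel n a i.+1 j.+1 k.+1 - s3_rel n a j.+1 i.+1 k.+1.

Lemma s3_sc_alt (K : fieldType) (n : nat) (a : nat -> K) (i k : 'I_n.+1) :
  s3_sc a i i k = 0.
Proof. exact: subrr. Qed.

Lemma s3_sc_anti (K : fieldType) (n : nat) (a : nat -> K) (i j k : 'I_n.+1) :
  s3_sc a i j k = - s3_sc a j i k.
Proof. by rewrite /s3_sc opprB. Qed.

Definition s3_act (K : fieldType) (n : nat) (a : nat -> K) (j : 'I_n.+1)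
    : 'M[K]_n.+1 :=
  \matrix_(i, k) s3_rel n a i.+1 j.+1 k.+1.


Lemma s3_actP (K : fieldType) (n : nat) (a : nat -> K) (j i k : 'I_n.+1) :
  s3_act a j i k != 0 -> (n <= j.+1)%N && (k.+1 < n)%N.
Proof.
rewrite mxE /s3_rel.
case: ifP => [/andP[/eqP -> h]|_].
  rewrite leqnn /=; case: (k.+1 =P i.+1.-1) => [e _|]; last by rewrite eqxx.
  by move: h => /=; lia.
case: ifP => [/andP[/eqP -> h]|_]; last by rewrite eqxx.
case: (k.+1 =P i.+1) => [->|_]; first by move=> _; lia.
by case: ifP => h2; rewrite ?addr0 ?eqxx // => _; lia.
Qed.

Lemma s3_act_low (K : fieldType) (n : nat) (a : nat -> K) (j : 'I_n.+1) :
  (j.+1 < n)%N -> s3_act a j = 0.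
Proof.
move=> h; apply/matrixP => i k; rewrite [RHS]mxE; apply/eqP.
by apply: contraTT h => /s3_actP; lia.
Qed.

(* e_n acts by a shift, e_(n+1) by a polynomial in that shift. *)
Lemma s3_act_comm0 (K : fieldType) (n : nat) (a : nat -> K) (p q : 'I_n.+1) :
  p.+1 = n -> q.+1 = n.+1 ->
  s3_act a p *m s3_act a q = s3_act a q *m s3_act a p.
Proof.
move=> hp hq; apply/matrixP => i l; rewrite !mxE.
pose f p q r := s3_rel n a p q r.
have L : \sum_m s3_act a p i m * s3_act a q m l =
    if (2 <= i.+1 <= n.-1)%N then f i q.+1 l.+1 else 0.
  case: ifP => h; last first.
    apply: big1 => m _; rewrite !mxE /s3_rel hp eqxx /= h.
    by case: ifP => [/andP[/eqP]|]; rewrite ?mul0r //; lia.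
  have hi : (i.-1 < n.+1)%N by have := ltn_ord i; lia.
  rewrite (bigD1 (Ordinal hi)) //= big1 ?addr0.
    rewrite !mxE [X in X * _]/s3_rel hp eqxx h /= /f.
    by rewrite (_ : i.-1.+1 = i) ?eqxx ?mul1r //; lia.
  move=> m hm; rewrite !mxE [X in X * _]/s3_rel hp eqxx h /=.
  case: eqP => e; rewrite ?mul0r //; case/eqP: hm; apply: val_inj => /=; lia.
have Rr : \sum_m s3_act a q i m * s3_act a p m l =
    if (l.+2 <= n.-1)%N then f i.+1 q.+1 l.+2 else 0.
  case: ifP => h; last first.
    apply: big1 => m _; rewrite !mxE [X in _ * X]/s3_rel hp eqxx /=.
    case: ifP => h2; last by case: ifP => [/andP[/eqP]|]; rewrite ?mulr0 //; lia.
    by case: eqP => e; rewrite ?mulr0 //; lia.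
  have hl : (l.+1 < n.+1)%N by lia.
  rewrite (bigD1 (Ordinal hl)) //= big1 ?addr0.
    rewrite !mxE [X in _ * X]/s3_rel hp eqxx /=.
    by rewrite h eqxx mulr1.
  move=> m hm; rewrite !mxE [X in _ * X]/s3_rel hp eqxx /=.
  case: ifP => h2; last by case: ifP => [/andP[/eqP]|]; rewrite ?mulr0 //; lia.
  case: eqP => e; rewrite ?mulr0 //; case/eqP: hm; apply: val_inj => /=; lia.
rewrite L Rr /f /s3_rel hq.
rewrite (_ : (n.+1 == n) = false) ?eqxx //=; last lia.
have hl := ltn_ord l.
rewrite !eqSS; case: (l.+1 =P i) => e; do ![case: ifP => ?];
  rewrite ?addr0 ?add0r //; try (by exfalso; lia).
Qed.

Lemma s3_act_comm (K : fieldType) (n : nat) (a : nat -> K) (p q : 'I_n.+1) :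
  s3_act a p *m s3_act a q = s3_act a q *m s3_act a p.
Proof.
have [hp|hp] := ltnP p.+1 n; first by rewrite s3_act_low // mul0mx mulmx0.
have [hq|hq] := ltnP q.+1 n; first by rewrite (s3_act_low a hq) mul0mx mulmx0.
have [<-//|npq] := eqVneq p q.
have {}npq : (p : nat) != q by exact: npq.
have ip := ltn_ord p; have iq := ltn_ord q.
have [e|e] := eqVneq p.+1 n; first by apply: s3_act_comm0; lia.
by apply/esym/s3_act_comm0; lia.
Qed.

Lemma s3_sc_jacobi (K : fieldType) (n : nat) (a : nat -> K)
    (i j k l : 'I_n.+1) :
  \sum_m (s3_sc a i j m * s3_sc a m k l + s3_sc a j k m * s3_sc a m i l
          + s3_sc a k i m * s3_sc a m j l) = 0.
Proof.
pose T := s3_act (n := n) a.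
have E p q r : \sum_m s3_sc a p q m * s3_sc a m r l =
    (T q *m T r) p l - (T p *m T r) q l.
  rewrite !mxE -sumrB; apply: eq_bigr => m _.
  have -> : s3_sc a p q m = T q p m - T p q m by rewrite !mxE.
  have -> : s3_sc a m r l = T r m l - T m r l by rewrite !mxE.
  have -> : (T q p m - T p q m) * (T r m l - T m r l) =
            (T q p m - T p q m) * T r m l.
    have [hm|hm] := ltnP m.+1 n.
      have -> : T m r l = 0 by rewrite /T s3_act_low // mxE.
      by rewrite subr0.
    suff z s t : T s t m = 0 by rewrite !z subrr !mul0r.
    by apply/eqP; apply: contraTT hm => /s3_actP; lia.
  by rewrite mulrBl.
rewrite !big_split /= !E.
rewrite /T (s3_act_comm a j k) (s3_act_comm a i k) (s3_act_comm a j i).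
by rewrite addrACA addrC !addrA; ring.
Qed.

Definition s3 (K : fieldType) (n : nat) (a : nat -> K) : lie_algebra K n.+1 :=
  LieAlgebra (@s3_sc_alt K n a) (@s3_sc_anti K n a) (@s3_sc_jacobi K n a).

(* The coordinate of x with label k, for 1 <= k <= n + 1. *)
Definition crd (K : fieldType) (n : nat) (x : 'rV[K]_n.+1) (k : nat) : K :=
  x 0 (inord k.-1).

Definition s3_xi (K : fieldType) (n : nat) (x : 'rV[K]_n.+1) (k : nat) : K :=
  if k == 1%N then crd x 1
  else if k == 2%N then 0
  else \sum_(1 <= j < k.+1)
         (-1) ^+ (k - j) / ((k - j)`!)%:R
         * crd x 1 ^ (j%:Z - 2) * crd x 2 ^+ (k - j) * crd x j.

(* The factor xi_1^(1-l) xi_l, homogeneous of degree 0 in the coordinates.    *)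
(* For l = 1 it is 1, the value of the summation formula for xi_k at k = 1    *)
(* (at k = 2 that formula does give 0).  The literal xi_1^0 xi_1 = x_1 would  *)
(* not yield invariants: for n = 4, k = 3, a_3 != 0 the function              *)
(* xi_1^-2 xi_3 - a_3 ln x_1 is invariant, xi_1^-2 xi_3 - a_3 x_1 ln x_1 not. *)
Definition s3_xi_factor (K : fieldType) (n : nat) (x : 'rV[K]_n.+1) (l : nat)
    : K :=
  if l == 1%N then 1 else s3_xi x 1 ^ (1 - l%:Z) * s3_xi x l.

Definition s3_b (K : fieldType) (n : nat) (a : nat -> K) (m i : nat) : K :=
  \sum_(s : {ffun 'I_i -> 'I_n} |
          [forall t, (3 <= s t)%N] && ((\sum_t s t)%N == (m + i)%N))
    \prod_t a (s t).

Definition s3_casimir (R : realType) (n : nat) (a : nat -> cplx R)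
    (L : cplx R -> cplx R) (k : nat) (x : 'rV[cplx R]_n.+1) : cplx R :=
  s3_xi_factor x k +
  \sum_(2 <= m < k) s3_xi_factor x (k - m)%N *
    \sum_(1 <= i < (m./2).+1) s3_b n a m i / i`!%:R * (- L (s3_xi x 1)) ^+ i.

(* Main.v *)
Require Import Defs.
From mathcomp Require Import all_boot all_order all_algebra.
From mathcomp Require Import complex zify ring lra.
From mathcomp Require Import all_classical all_reals all_analysis.
Set Implicit Arguments.
Unset Strict Implicit.
Unset Printing Implicit Defensive.
Import Order.TTheory GRing.Theory Num.Theory numFieldNormedType.Exports.
Local Open Scope classical_set_scope.
Local Open Scope ring_scope.

(* Encode a point x by X(z) = \sum_(1 <= j < n) x_j z^(j-1), and put            *)
(* p(z) = \sum_(3 <= s < n) a_s z^(s-1).  Modulo z^(n-1) the coadjoint action   *)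
(* of exp u, with s = u_n and t = u_(n+1), multiplies X by                      *)
(* exp (s z + t (1 + p)).  Hence it multiplies x_1 by exp t, adds t to ln x_1   *)
(* and s to x_2 / x_1, so that it leaves fixed                                  *)
(*   exp (- (ln x_1) p - (x_2 / x_1) z) X / x_1,                                *)
(* whose coefficients of z^2, ..., z^(n-2) are the claimed invariants.          *)
(* For fixed x_1 and x_2 these depend on x_3, ..., x_(n-1) by an invertible     *)
(* affine map, whence their independence.                                       *)

(** * Truncated exponentials *)

(** The computation takes place among polynomials modulo z^(n-1) ([eq_upto n.-1]). There, for [q]
    without constant term, [exp_trunc n.-1 q] represents the power series exp q, and
    [exp_trunc_mul_upto] gives exp q exp r = exp (q + r).

    Two identities carry the proof. [crd_poly_coadjoint_exp] turns the group action into
    multiplication by e^t exp (s z + t p); the constant t, not being nilpotent, is split off and its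
    series converges to [cexp t] by [cvg_exp_trunc]. [s3_casimirE] recognizes the expression of
    label k as the coefficient of z^(k-1) in exp (- [s3_arg]) X / x_1: b_mi is the coefficient of
    z^m in p^i ([coef_s3_polyX]), and the factors xi_1^(1-l) xi_l are coefficients of exp (- (x_2 /
    x_1) z) X / x_1 ([s3_xi_factorE]). Invariance is then a cancellation
    ([s3_casimir_coadjoint_exp]), valid as long as ln x_1 grows by exactly t, which holds for small
    t ([log_branch_mul_cexp]).

    For the count, e_1, ..., e_(n-1) commute, so that the commutator matrix has rank at most 4, and
    the value 4 is attained ([s3_rank_le4], [s3_rank_eq4]). For independence, [point_of_invariants]
    is a continuous section of the invariants through a given point; it pulls a relation on an open
    set back to an open set of values. *)

Definition exp_trunc (A : unitRingType) (K : nat) (x : A) : A :=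
  \sum_(k < K) x ^+ k / k`!%:R.

Lemma exp_truncS (A : unitRingType) (K : nat) (x : A) :
  exp_trunc K.+1 x = exp_trunc K x + x ^+ K / K`!%:R.
Proof. by rewrite /exp_trunc big_ord_recr. Qed.

(** Induction on [K]: the step adds x^j y^(K-j) / (j! (K-j)!) to the term of index j on the right,
    and by the binomial formula these add up to (x + y)^K / K!. *)
Lemma exp_truncD (A : comUnitRingType) (K : nat) (x y : A) :
  (forall k, k.+1%:R \is a @GRing.unit A) ->
  exp_trunc K (x + y) = \sum_(j < K) x ^+ j / j`!%:R * exp_trunc (K - j) y.
Proof.
move=> A0; have fu k : k`!%:R \is a @GRing.unit A.
  by rewrite -(prednK (fact_gt0 k)).
elim: K => [|K IH]; first by rewrite /exp_trunc !big_ord0.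
transitivity (\sum_(j < K.+1) x ^+ j / j`!%:R *
  (exp_trunc (K - j) y + y ^+ (K - j) / (K - j)`!%:R)); last first.
  by apply: eq_bigr => i _; rewrite subSn -1?ltnS // exp_truncS.
under eq_bigr do rewrite mulrDr.
rewrite big_split /= big_ord_recr /= subnn {3}/exp_trunc big_ord0 mulr0 addr0.
rewrite exp_truncS IH; congr (_ + _).
rewrite addrC exprDn mulr_suml; apply: eq_bigr => i _.
have iK : (i <= K)%N by rewrite -ltnS.
have cu : 'C(K, i)%:R \is a @GRing.unit A.
  by rewrite -(@prednK 'C(K, i)) // bin_gt0.
rewrite -(bin_fact iK) !natrM -mulr_natr.
apply: (mulIr (fu i)); apply: (mulIr (fu (K - i)%N)); apply: (mulIr cu).
rewrite !invrM ?unitrM ?fu ?cu //; move: (fu i) (fu (K - i)%N) cu.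
move: (i`!%:R : A) ((K - i)`!%:R : A) ('C(K, i)%:R : A) => u v w Hu Hv Hw.
transitivity (x ^+ i * y ^+ (K - i) * w * (u * u^-1) * (v * v^-1) * (w * w^-1)).
  ring.
transitivity (x ^+ i * y ^+ (K - i) * w * (u * u^-1) * (v * v^-1)); last by ring.
by rewrite !divrr // !mulr1.
Qed.

(** Congruence modulo X^d. *)
Definition eq_upto (K : fieldType) (d : nat) (p q : {poly K}) : Prop :=
  forall i, (i < d)%N -> p`_i = q`_i.

Lemma eq_upto_mul (K : fieldType) (d : nat) (p p' q q' : {poly K}) :
  eq_upto d p p' -> eq_upto d q q' -> eq_upto d (p * q) (p' * q').
Proof.
move=> hp hq i id; rewrite !coefM; apply: eq_bigr => j _.
by have ji := ltn_ord j; rewrite hp ?hq //; lia.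
Qed.

Lemma unit_natr_poly (K : numFieldType) (k : nat) :
  k.+1%:R \is a @GRing.unit {poly K}.
Proof.
by rewrite -polyC_natr poly_unitE size_polyC coefC eqxx unitfE pnatr_eq0.
Qed.

Lemma poly_div_nat (K : numFieldType) (p : {poly K}) (k : nat) :
  p / k%:R = k%:R^-1 *: p.
Proof. by rewrite -polyC_natr polyCV mulrC mul_polyC. Qed.

Lemma coef_exprM_low (K : fieldType) (q r : {poly K}) (i j m : nat) :
  q`_0 = 0 -> r`_0 = 0 -> (m < i + j)%N -> (q ^+ i * r ^+ j)`_m = 0.
Proof.
have E (s : {poly K}) : s`_0 = 0 -> exists t, s = 'X * t.
  move=> s0; exists (s %/ 'X); rewrite mulrC divpK //.
  by rewrite -['X]subr0 -polyC0 dvdp_XsubCl /root horner_coef0 s0.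
move=> /E [q' ->] /E [r' ->] h.
by rewrite !exprMn mulrACA -exprD coefXnM h.
Qed.

Lemma exp_trunc0 (A : unitRingType) (d : nat) : (0 < d)%N ->
  exp_trunc d 0 = 1 :> A.
Proof.
case: d => // d _; rewrite /exp_trunc big_ord_recl big1 ?addr0.
  by rewrite expr0 fact0 divr1.
by move=> i _; rewrite expr0n /= mul0r.
Qed.

Lemma exp_trunc_sub (A : unitRingType) (j K : nat) (y : A) : (j <= K)%N ->
  exp_trunc K y - exp_trunc (K - j) y =
  \sum_(K - j <= i < K) y ^+ i / i`!%:R.
Proof.
move=> jK; rewrite /exp_trunc -!(big_mkord xpredT (fun i => y ^+ i / i`!%:R)).
rewrite (big_cat_nat (n := K - j)) //=; last by lia.
by rewrite addrAC subrr add0r.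
Qed.

(** The defect contains only monomials of total degree at least [K], with positive coefficients. The
    degree makes it vanish modulo X^K for polynomials without constant term; the positivity bounds
    it, over a field, by its value at the norms. *)
Lemma exp_trunc_mul (A : comUnitRingType) (K : nat) (x y : A) :
  (forall k, k.+1%:R \is a @GRing.unit A) ->
  exp_trunc K x * exp_trunc K y - exp_trunc K (x + y) =
  \sum_(j < K) \sum_(K - j <= i < K)
     (x ^+ j / j`!%:R) * (y ^+ i / i`!%:R).
Proof.
move=> A0; rewrite exp_truncD // {1}/exp_trunc mulr_suml -sumrB.
apply: eq_bigr => j _; rewrite -mulrBr exp_trunc_sub ?mulr_sumr //.
exact: ltnW.
Qed.

Lemma exp_trunc_mul_upto (K : numFieldType) (d : nat) (q r : {poly K}) :
  q`_0 = 0 -> r`_0 = 0 ->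
  eq_upto d (exp_trunc d q * exp_trunc d r) (exp_trunc d (q + r)).
Proof.
move=> q0 r0 m md; apply/eqP; rewrite -subr_eq0 -coefB.
rewrite (exp_trunc_mul _ _ _ (@unit_natr_poly K)) coef_sum; apply/eqP.
apply: big1 => j _; rewrite coef_sum big_nat_cond big1 // => i.
rewrite andbT => /andP[hi _]; rewrite !poly_div_nat -scalerAl -scalerAr !coefZ.
by rewrite coef_exprM_low ?mulr0 //; lia.
Qed.

Lemma exp_trunc_inv_upto (K : numFieldType) (d : nat) (q : {poly K}) :
  q`_0 = 0 -> eq_upto d (exp_trunc d q * exp_trunc d (- q)) 1.
Proof.
move=> q0 m md; rewrite exp_trunc_mul_upto ?coefN ?q0 ?oppr0 //.
by rewrite subrr exp_trunc0 //; lia.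
Qed.

Lemma coef0_exp_trunc (K : numFieldType) (d : nat) (q : {poly K}) :
  q`_0 = 0 -> (0 < d)%N -> (exp_trunc d q)`_0 = 1.
Proof.
case: d => // d q0 _; rewrite /exp_trunc big_ord_recl coefD coef_sum big1.
  by rewrite expr0 fact0 divr1 addr0 coef1.
move=> i _; rewrite poly_div_nat coefZ exprS coefM big_ord1 q0 mul0r mulr0 //.
Qed.

Lemma coef1_exp_trunc (K : numFieldType) (d : nat) (q : {poly K}) :
  q`_0 = 0 -> (1 < d)%N -> (exp_trunc d q)`_1 = q`_1.
Proof.
case: d => [|[|d]] // q0 _; rewrite /exp_trunc !big_ord_recl !coefD coef_sum.
rewrite big1 ?addr0.
  by rewrite expr0 fact0 divr1 coef1 add0r expr1 divr1.
move=> i _; rewrite poly_div_nat coefZ -[q ^+ _]mul1r -(expr0 q).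
by rewrite coef_exprM_low ?mulr0 // add0n.
Qed.

(** * The complex exponential and branches of the logarithm *)

Lemma unit_natr_field (K : numFieldType) (k : nat) :
  k.+1%:R \is a @GRing.unit K.
Proof. by rewrite unitfE pnatr_eq0. Qed.

(* Reduces exp (x + y) = exp x * exp y for complex x and y to the same law for  *)
(* the reals |x| and |y|, where it is in the library.                           *)
Lemma norm_exp_trunc_mul (K : numFieldType) (N : nat) (x y : K) :
  `|exp_trunc N x * exp_trunc N y - exp_trunc N (x + y)| <=
  exp_trunc N `|x| * exp_trunc N `|y| - exp_trunc N (`|x| + `|y|).
Proof.
rewrite !(exp_trunc_mul _ _ _ (@unit_natr_field K)).
apply: (le_trans (ler_norm_sum _ _ _)); apply: ler_sum => j _.
apply: (le_trans (ler_norm_sum _ _ _)); apply: ler_sum => i _.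
by rewrite !normrM !normfV !normrX !normr_nat.
Qed.

Lemma norm_exp_trunc_sub2 (K : numFieldType) (N : nat) (x : K) :
  `|exp_trunc N.+2 x - 1 - x| <= exp_trunc N.+2 `|x| - 1 - `|x|.
Proof.
have E (y : K) : exp_trunc N.+2 y - 1 - y =
    \sum_(i < N) y ^+ i.+2 / (i.+2)`!%:R.
  rewrite /exp_trunc !big_ord_recl /= expr0 fact0 expr1 !divr1.
  by rewrite -addrA -opprD addrA (addrC _ (\sum_(i < N) _)) addrK.
rewrite !E.
apply: (le_trans (ler_norm_sum _ _ _)); apply: ler_sum => j _.
by rewrite normrM normfV normrX normr_nat.
Qed.

Definition cR (R : realType) (x : R) : cplx R := (x%:C)%C.

Lemma cR_ge0P (R : realType) (z : cplx R) : 0 <= z -> exists2 r : R, 0 <= r & z = cR r.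
Proof.
case: z => a b; rewrite lecE /= => /andP[/eqP -> a0]; by exists a.
Qed.

Lemma norm_cR (R : realType) (x : R) : `|cR x| = cR `|x|.
Proof. by rewrite /cR normc_def /= expr0n /= addr0 sqrtr_sqr. Qed.

Lemma cR_sum (R : realType) (I : Type) (s : seq I) (P : pred I) (f : I -> R) :
  cR (\sum_(i <- s | P i) f i) = \sum_(i <- s | P i) cR (f i).
Proof. exact: (rmorph_sum (real_complex R)). Qed.

Lemma cR_exp_trunc (R : realType) (N : nat) (x : R) :
  exp_trunc N (cR x) = cR (exp_trunc N x).
Proof.
rewrite /exp_trunc cR_sum; apply: eq_bigr => i _.
by rewrite /cR rmorphM fmorphV rmorphXn rmorph_nat.
Qed.

Lemma cvg_cplx (R : realType) (T : Type) (F : set_system T) {FF : Filter F}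
    (u : T -> cplx R) (a b : R) :
  complex.Re (u x) @[x --> F] --> a -> complex.Im (u x) @[x --> F] --> b ->
  u @ F --> ((a +i* b)%C : cplx R).
Proof.
move=> /cvgrPdist_lt ha /cvgrPdist_lt hb; apply/cvgrPdist_lt => e e0.
have [r r0 re] := cR_ge0P (ltW e0); rewrite re ltcR in e0.
have r2 : 0 < r / 2 by rewrite divr_gt0.
near=> x.
rewrite [X in `|X|]complexE /= (le_lt_trans (ler_normD _ _)) //.
rewrite normrM normCi mul1r !norm_cR re /cR -rmorphD ltcR.
rewrite (splitr r); apply: ltrD.
  by rewrite raddfB /=; near: x; apply: ha.
by rewrite raddfB /=; near: x; apply: hb.
Unshelve. all: by end_near. Qed.

Lemma cvg_cR (R : realType) (T : Type) (F : set_system T) {FF : Filter F}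
    (u : T -> R) (a : R) :
  u @ F --> a -> cR (u x) @[x --> F] --> cR a.
Proof. by move=> h; apply: cvg_cplx => //=; apply: cvg_cst. Qed.

Lemma exp_trunc_series (R : realType) (x : R) :
  (fun N => exp_trunc N x) = series (exp_coeff x).
Proof. by apply/funext => N; rewrite /series /= big_mkord. Qed.

Lemma cvg_exp_trunc_real (R : realType) (x : R) :
  exp_trunc N x @[N --> \oo] --> expR x.
Proof. by rewrite exp_trunc_series; apply: is_cvg_series_exp_coeff. Qed.

Lemma exp_trunc_le_expR (R : realType) (N : nat) (x : R) : 0 <= x ->
  exp_trunc N x <= expR x.
Proof.
move=> x0; rewrite /expR -exp_trunc_series.
apply: (nondecreasing_cvgn_le (u_ := fun N => exp_trunc N x)); last first.
  by apply/cvg_ex; exists (expR x); apply: cvg_exp_trunc_real.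
move=> m n /subnK <-; rewrite addnC /exp_trunc.
elim: (n - m)%N => [|k IH]; first by rewrite addn0.
rewrite addnS big_ord_recr /= (le_trans IH) // lerDl.
by rewrite divr_ge0 // exprn_ge0.
Qed.

Lemma cvg0_norm_le (K : numFieldType) (T : Type) (F : set_system T)
    {FF : Filter F} (f g : T -> K) :
  (forall x, `|f x| <= g x) -> g @ F --> 0 -> f @ F --> 0.
Proof.
move=> h /cvgr0Pnorm_lt hg; apply/cvgr0Pnorm_lt => e e0.
have := hg e e0; apply: filterS => x; apply: le_lt_trans.
by rewrite (ger0_norm (le_trans (normr_ge0 _) (h x))).
Qed.

Lemma cexpD (R : realType) (z w : cplx R) : cexp (z + w) = cexp z * cexp w.
Proof.
case: z => a b; case: w => c d; rewrite /cexp /= expRD cosD sinD.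
by apply/eqP; rewrite eq_complex /=; apply/andP; split; apply/eqP; ring.
Qed.

Lemma cexp0 (R : realType) : cexp 0 = 1 :> cplx R.
Proof. by rewrite /cexp /= expR0 cos0 sin0 mulr1 mulr0. Qed.

Lemma cexpN (R : realType) (z : cplx R) : cexp z * cexp (- z) = 1.
Proof. by rewrite -cexpD subrr cexp0. Qed.

Lemma cexp_neq0 (R : realType) (z : cplx R) : cexp z != 0.
Proof.
apply/eqP => e; have := cexpN z; rewrite e mul0r => /eqP.
by rewrite eq_sym oner_eq0.
Qed.

(** The shape is that of [cos_coeff] and [sin_coeff], so that the partial sums of exp (i b) have
    exactly those of cos and sin as real and imaginary parts. *)
Lemma expCi_half (R : realType) (k : nat) :
  ('i%C : cplx R) ^+ k =
  ((~~ odd k)%:R * (-1) ^+ k./2 +i* ((odd k)%:R * (-1) ^+ k.-1./2))%C.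
Proof.
elim/ltn_ind: k => -[|[|k]] IH.
- by rewrite expr0 /= mul0r mulr1.
- by rewrite expr1 /= mul0r mulr1.
rewrite exprS exprS mulrA IH // /= negbK.
have -> : ('i%C * 'i%C : cplx R) = -1 by rewrite -expr2 sqr_i.
rewrite mulN1r /=.
apply/eqP; rewrite eq_complex /=; apply/andP; split; apply/eqP.
  by rewrite exprS mulN1r mulrN.
case: (boolP (odd k)) => [ok|]; last by rewrite !mul0r oppr0.
by case: k ok {IH} => // k ok /=; rewrite exprS mulN1r mulrN.
Qed.

Lemma cvg_exp_trunc_im (R : realType) (b : R) :
  exp_trunc N ('i%C * cR b) @[N --> \oo] --> (((cos b) +i* (sin b))%C : cplx R).
Proof.
have E k : ('i%C * cR b) ^+ k / k`!%:R = (cos_coeff b k +i* sin_coeff b k)%C.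
  have -> : (k`!%:R : cplx R) = cR k`!%:R by rewrite /cR rmorph_nat.
  rewrite exprMn expCi_half /cR -rmorphXn -fmorphV /cos_coeff /sin_coeff /=.
  rewrite -!exprnP.
  by apply/eqP; rewrite eq_complex /=; apply/andP; split; apply/eqP; ring.
have Sre N : complex.Re (exp_trunc N ('i%C * cR b)) = series (cos_coeff b) N.
  rewrite /exp_trunc /series /= raddf_sum big_mkord.
  by apply: eq_bigr => k _; rewrite E.
have Sim N : complex.Im (exp_trunc N ('i%C * cR b)) = series (sin_coeff b) N.
  rewrite /exp_trunc /series /= raddf_sum big_mkord.
  by apply: eq_bigr => k _; rewrite E.
apply: (cvg_cplx (u := fun N => exp_trunc N ('i%C * cR b))).
  under eq_fun do rewrite Sre.
  by have := @is_cvg_series_cos_coeff R b; rewrite unlock.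
under eq_fun do rewrite Sim.
by have := @is_cvg_series_sin_coeff R b; rewrite unlock.
Qed.

(** The product of the truncations tends to a b, and its distance to the truncation at x + y is
    dominated by the defect at the norms, which the last hypothesis sends to 0. *)
Lemma cvg_exp_truncD (K : numFieldType) (x y a b : K) :
  exp_trunc N x @[N --> \oo] --> a -> exp_trunc N y @[N --> \oo] --> b ->
  exp_trunc N `|x| * exp_trunc N `|y| - exp_trunc N (`|x| + `|y|)
    @[N --> \oo] --> 0 ->
  exp_trunc N (x + y) @[N --> \oo] --> a * b.
Proof.
move=> ha hb h0.
have h : exp_trunc N x * exp_trunc N y - exp_trunc N (x + y)
    @[N --> \oo] --> 0.
  exact: cvg0_norm_le (fun N => norm_exp_trunc_mul N x y) h0.
rewrite (_ : (fun N => _) = fun N => exp_trunc N x * exp_trunc N y -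
    (exp_trunc N x * exp_trunc N y - exp_trunc N (x + y))).
  by rewrite -[a * b]subr0; apply: cvgB (cvgM ha hb) h.
by apply/funext => N; rewrite subKr.
Qed.

Lemma cexp_cart (R : realType) (a b : R) :
  cexp (a +i* b)%C = cR (expR a) * ((cos b) +i* (sin b))%C.
Proof.
by apply/eqP; rewrite /cR eq_complex /= !mul0r subr0 addr0 !eqxx.
Qed.

Lemma cplx_cart (R : realType) (a b : R) :
  (a +i* b)%C = cR a + 'i%C * cR b :> cplx R.
Proof. by rewrite [LHS]complexE. Qed.

Lemma norm_i_cR (R : realType) (b : R) : `|'i%C * cR b| = cR `|b|.
Proof. by rewrite normrM normCi mul1r norm_cR. Qed.

(** Links [cexp], given by its polar form, to the series behind [exp_mx]. For t = a + i b the two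
    summands are settled by the real exponential and by cos and sin; the defect at |a|, |b| tends to
    0 by [expRD]. *)
Lemma cvg_exp_trunc (R : realType) (t : cplx R) :
  exp_trunc N t @[N --> \oo] --> cexp t.
Proof.
case: t => a b; rewrite cexp_cart (cplx_cart a b).
apply: cvg_exp_truncD; last 1 first.
- rewrite norm_i_cR norm_cR.
  have -> : cR `|a| + cR `|b| = cR (`|a| + `|b|) by rewrite /cR rmorphD.
  under eq_fun do rewrite !cR_exp_trunc /cR -rmorphM -rmorphB -!/(cR _).
  rewrite -[0]/(cR 0) -(subrr (expR (`|a| + `|b|))) {1}expRD.
  apply: (cvg_cR (u := fun N => exp_trunc N `|a| * exp_trunc N `|b|
     - exp_trunc N (`|a| + `|b|))).
  by apply: cvgB; [apply: cvgM|]; apply: cvg_exp_trunc_real.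
- under eq_fun do rewrite cR_exp_trunc.
  by apply: (cvg_cR (u := fun N => exp_trunc N a)); apply: cvg_exp_trunc_real.
- exact: cvg_exp_trunc_im.
Qed.

(** The remainder series has positive coefficients, so it is bounded by the remainder of [expR] at r
    = |h|; the bound passes to the limit up to an arbitrary e. *)
Lemma cexp_taylor1 (R : realType) (h : cplx R) : `|h| <= 2^-1 ->
  `|cexp h - 1 - h| <= 2 * `|h| ^+ 2.
Proof.
have [r r0 hr] := cR_ge0P (normr_ge0 h).
have -> : 2^-1 = cR 2^-1 :> cplx R by rewrite /cR fmorphV rmorph_nat.
rewrite hr lecR => r2.
(* From e^(-r) >= 1 - r follows e^r (1 - r) <= 1, hence e^r - 1 - r <= r^2 / (1 - r) <= 2 r^2, as r
   <= 1/2. *)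
have er : expR r - 1 - r <= 2 * r ^+ 2.
  have h1 : 1 - r <= expR (- r) by exact: expR_ge1Dx.
  have h2 : expR r * (1 - r) <= 1.
    by rewrite -[leRHS](expRxMexpNx_1 r) ler_pM2l ?expR_gt0.
  by have := expR_gt0 r; nra.
apply/ler_addgt0Pr => e e0.
have /cvgrPdist_lt/(_ e e0) := @cvg_exp_trunc R h.
move=> -[N _ /(_ N.+2 (leqW (leqnSn N))) /= hN].
have -> : cexp h - 1 - h = (cexp h - exp_trunc N.+2 h) + (exp_trunc N.+2 h - 1 - h).
  by ring.
apply: le_trans (ler_normD _ _) _; rewrite [leLHS]addrC.
apply: lerD; last exact: ltW.
apply: le_trans (norm_exp_trunc_sub2 N h) _.
rewrite hr cR_exp_trunc.
have -> : cR (exp_trunc N.+2 r) - 1 - cR r = cR (exp_trunc N.+2 r - 1 - r).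
  by rewrite /cR !rmorphB rmorph1.
have -> : 2 * cR r ^+ 2 = cR (2 * r ^+ 2).
  by rewrite /cR rmorphM rmorphXn rmorph_nat.
rewrite lecR (le_trans _ er) // lerD2r lerD2r.
exact: exp_trunc_le_expR.
Qed.

Lemma cexp_taylor1_half (R : realType) (h : cplx R) : `|h| <= 4^-1 ->
  `|cexp h - 1 - h| <= 2^-1 * `|h|.
Proof.
move=> h4; apply: le_trans (cexp_taylor1 _) _.
  by apply: le_trans h4 _; rewrite lef_pV2 ?posrE // ler_nat.
rewrite expr2 mulrA ler_wpM2r //.
have -> : 2^-1 = 2 * 4^-1 :> cplx R by field.
by rewrite ler_pM2l.
Qed.

(** If e^h = 1, the Taylor bound reads |h| <= |h| / 2. This is what separates the values of the
    logarithm at a point. *)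
Lemma cexp_eq1_small (R : realType) (h : cplx R) : `|h| <= 4^-1 ->
  cexp h = 1 -> h = 0.
Proof.
move=> h4 e; have := cexp_taylor1_half h4; rewrite e subrr sub0r normrN.
rewrite -subr_le0 (_ : _ - _ = 2^-1 * `|h|); last by field.
by rewrite pmulr_rle0 ?invr_gt0 ?ltr0n // normr_le0 => /eqP.
Qed.

Lemma cexp_sub1_ge (R : realType) (h : cplx R) : `|h| <= 4^-1 ->
  2^-1 * `|h| <= `|cexp h - 1|.
Proof.
move=> h4; have := cexp_taylor1_half h4.
have /= := lerB_normD (cexp h - 1 - h) h.
rewrite subrK => h1 h2.
have := ler_normB (cexp h - 1) (cexp h - 1 - h).
rewrite (_ : cexp h - 1 - (cexp h - 1 - h) = h); last by ring.
move=> h3; rewrite -(lerD2r (2^-1 * `|h|)).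
rewrite (_ : 2^-1 * `|h| + _ = `|h|); last by field.
by apply: le_trans h3 _; rewrite lerD2l.
Qed.

Lemma cexp_sub1_le (R : realType) (h : cplx R) : `|h| <= 4^-1 ->
  `|cexp h - 1| <= 2 * `|h|.
Proof.
move=> h4; rewrite -[cexp h - 1](subrK h) (le_trans (ler_normD _ _)) //.
rewrite mulr_natl mulr2n lerD2r (le_trans (cexp_taylor1_half h4)) //.
by rewrite ler_piMl // invf_le1 ?ler1n.
Qed.

Lemma near0_norm_le (K : numFieldType) (e : K) : 0 < e ->
  \forall h \near (0 : K), `|h| <= e.
Proof.
move=> e0; have /cvgr0Pnorm_le/(_ e e0) : (fun h : K => h) @ (0 : K) --> (0 : K).
  exact: cvg_id.
exact.
Qed.

Lemma cvg_cexp0 (R : realType) : cexp h @[h --> (0 : cplx R)] --> (1 : cplx R).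
Proof.
apply/(@cvgrPdist_le _ _ _ _ (nbhs_filter (0 : cplx R))) => e e0.
have e2 : 0 < e / 2 by rewrite divr_gt0.
have q0 : 0 < 4^-1 :> cplx R by rewrite invr_gt0.
near=> h.
rewrite distrC; apply: le_trans (cexp_sub1_le _) _.
  by near: h; apply: near0_norm_le.
rewrite mulrC -ler_pdivlMr //.
Unshelve. all: by end_near. Qed.

Lemma log_branch_neq0 (R : realType) (D : set (cplx R)) (L : cplx R -> cplx R)
    (z : cplx R) : log_branch D L -> D z -> z != 0.
Proof. by move=> [_ _ LE] /LE <-; apply: cexp_neq0. Qed.

(** L (e^t z) - L z - t has exponential 1 and tends to 0 with t by continuity of [L]; hence it is 0
    for small t. *)
Lemma log_branch_mul_cexp (R : realType) (D : set (cplx R))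
    (L : cplx R -> cplx R) (z : cplx R) : log_branch D L -> D z ->
  \forall t \near (0 : cplx R), D (cexp t * z) /\ L (cexp t * z) = L z + t.
Proof.
move=> [oD cL LE] Dz.
have cz : cexp t * z @[t --> (0 : cplx R)] --> z.
  rewrite -[X in _ --> X]mul1r.
  exact: (cvgM (@cvg_cexp0 R) (cvg_cst z)).
have cLz : L (cexp t * z) @[t --> (0 : cplx R)] --> L z.
  exact: cvg_comp cz (cL z Dz).
have nD : \forall t \near (0 : cplx R), D (cexp t * z).
  by apply: cz; apply: open_nbhs_nbhs.
have c0 : L (cexp t * z) - L z - t @[t --> (0 : cplx R)] --> (0 : cplx R).
  rewrite -[X in _ --> X](subr0 0) -[X in _ --> X - _](subrr (L z)).
  exact: (cvgB (cvgB cLz (cvg_cst _)) cvg_id).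
have q0 : 0 < 4^-1 :> cplx R by rewrite invr_gt0.
move/cvgr0Pnorm_le : c0 => /(_ _ q0) c0.
near=> t; have Dt : D (cexp t * z) by near: t.
split=> //; apply/eqP; rewrite -subr_eq0 opprD addrA; apply/eqP.
apply: cexp_eq1_small; first by near: t.
rewrite !cexpD LE //; have := cexpN (L z); rewrite (LE z Dz) => e.
by rewrite -[RHS](cexpN t) -[cexp t in RHS]mulr1 -e mulrA.
Unshelve. all: by end_near. Qed.

(** Put k = L (h + z) - L z, so that e^k = 1 + h / z and 1/z - k/h = (e^k - 1 - k) / h. The
    numerator is at most 2 |k|^2 and |h| is at least |k| |z| / 2, so the quotient is at most 4 |k| /
    |z|, which tends to 0 with h. *)
Lemma log_branch_differentiable (R : realType) (D : set (cplx R))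
    (L : cplx R -> cplx R) (z : cplx R) : log_branch D L -> D z ->
  differentiable L z.
Proof.
move=> LB Dz; have z0 := log_branch_neq0 LB Dz; case: LB => oD cL LE.
apply/derivable1_diffP; apply/cvg_ex; exists z^-1.
have sh : h + z @[h --> (0 : cplx R)^'] --> z.
  rewrite -[X in _ --> X]add0r.
  exact: (cvgD (@nbhs_dnbhs _ (0 : cplx R)) (cvg_cst z)).
have nD : \forall h \near (0 : cplx R)^', D (h + z).
  by apply: sh; apply: open_nbhs_nbhs.
have ck : L (h + z) - L z @[h --> (0 : cplx R)^'] --> (0 : cplx R).
  rewrite -[X in _ --> X](subrr (L z)).
  exact: (cvgB (cvg_comp _ _ sh (cL z Dz)) (cvg_cst (L z))).
have q0 : 0 < 4^-1 :> cplx R by rewrite invr_gt0.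
move/cvgr0Pnorm_le : ck => ck.
apply/cvgrPdist_le => e e0.
have nz : 0 < `|z| by rewrite normr_gt0.
have e4 : 0 < e * `|z| / 4 by rewrite divr_gt0 // mulr_gt0.
near=> h.
change (`|z^-1 - h^-1 * (L (h * 1 + z) - L z)| <= e); rewrite mulr1.
set k := L (h + z) - L z.
have h0 : h != 0 by near: h; apply: nbhs_dnbhs_neq.
have Dh : D (h + z) by near: h.
have k4 : `|k| <= 4^-1 by rewrite /k; near: h; exact: ck _ q0.
have ke : 4 * `|k| <= e * `|z|.
  rewrite mulrC -ler_pdivlMr ?ltr0n //.
  by rewrite /k; near: h; exact: ck _ e4.
have E : cexp k = h / z + 1.
  have := cexpN (L z); rewrite /k cexpD !LE // => e1.
  by rewrite -[cexp (- L z)](mulKf z0) e1 mulr1 mulrDl divff.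
have h2 : `|h| >= 2^-1 * `|k| * `|z|.
  rewrite -ler_pdivlMr //; have := cexp_sub1_ge k4.
  by rewrite E addrK normrM normfV.
have rE : z^-1 - h^-1 * k = (cexp k - 1 - k) / h.
  by rewrite E; field; rewrite h0 z0.
rewrite rE normrM normfV ler_pdivrMr ?normr_gt0 //.
have k2 : `|k| <= 2^-1 by apply: le_trans k4 _; rewrite lef_pV2 ?posrE // ler_nat.
apply: (le_trans (cexp_taylor1 k2)).
apply: le_trans (ler_wpM2l (ltW e0) h2).
rewrite (_ : 2 * _ = (2^-1 * `|k|) * (4 * `|k|)); last by field.
rewrite (_ : e * _ = (2^-1 * `|k|) * (e * `|z|)); last by ring.
by rewrite ler_wpM2l // mulr_ge0.
Unshelve. all: by end_near. Qed.

(** * The coadjoint action on generating polynomials *)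

Definition s3_poly (K : fieldType) (n : nat) (a : nat -> K) : {poly K} :=
  \sum_(s < n | (3 <= s)%N) a s *: 'X^(s.-1).

Definition crd_poly (K : fieldType) (n : nat) (x : 'rV[K]_n.+1) : {poly K} :=
  \poly_(i < n.-1) crd x i.+1.

Lemma coef_s3_poly (K : fieldType) (n : nat) (a : nat -> K) (m : nat) :
  (s3_poly n a)`_m = if (2 <= m < n.-1)%N then a m.+1 else 0.
Proof.
rewrite /s3_poly coef_sum; case: ifP => hm.
  have hn : (m.+1 < n)%N by lia.
  rewrite (bigD1 (Ordinal hn)) /=; last by lia.
  rewrite coefZ coefXn eqxx mulr1 big1 ?addr0 // => s /andP[s3 sm].
  rewrite coefZ coefXn; case: eqP => e; rewrite ?mulr0 //.
  by case/eqP: sm; apply: val_inj => /=; lia.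
apply: big1 => s s3; rewrite coefZ coefXn; case: eqP => e; rewrite ?mulr0 //.
by have := ltn_ord s; lia.
Qed.

Lemma coef_crd_poly (K : fieldType) (n : nat) (x : 'rV[K]_n.+1) (j : nat) :
  (j < n.-1)%N -> (crd_poly x)`_j = x 0 (inord j).
Proof. by move=> h; rewrite coef_poly h. Qed.

Lemma s3_relE (K : fieldType) (n : nat) (a : nat -> K) (j k : nat)
    (i : 'I_n.+1) : (j < n.-1)%N ->
  s3_rel n a j.+1 i.+1 k.+1 =
    (i == inord n.-1 :> 'I_n.+1)%:R * (k.+1 == j)%:R
  + (i == inord n :> 'I_n.+1)%:R *
      ((k == j)%:R + (if (k.+2 <= j)%N then a (j - k).+1 else 0)).
Proof.
move=> hj; have hi := ltn_ord i.
have -> : (i == inord n.-1 :> 'I_n.+1) = (i.+1 == n).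
  by rewrite -val_eqE /= inordK; lia.
have -> : (i == inord n :> 'I_n.+1) = (i.+1 == n.+1).
  by rewrite -val_eqE /= inordK.
rewrite /s3_rel; have [e|e] /= := eqVneq i.+1 n.
  rewrite (_ : (i.+1 == n.+1) = false) ?mul0r ?addr0 ?mul1r; last by lia.
  case: ifP => h; first by [].
  by rewrite (_ : (k.+1 == j) = false) //; lia.
rewrite mul0r add0r; case: eqP => e2 /=; last by rewrite mul0r.
rewrite (_ : (j < n.-1)%N = true) // eqSS mul1r; congr (_ + _).
rewrite (_ : (k < j.+1 - 2)%N = (k.+1 < j)%N); last by lia.
by case: ifP => // h; congr a; lia.
Qed.

Lemma s3_rel_low (K : fieldType) (n : nat) (a : nat -> K) (p q r : nat) :
  (q < n)%N -> s3_rel n a p q r = 0.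
Proof.
move=> h; rewrite /s3_rel; case: eqP => [e|_] /=; first lia.
by case: eqP => [e|_] //=; lia.
Qed.

Definition coad_poly (K : fieldType) (n : nat) (a : nat -> K)
    (u : 'rV[K]_n.+1) : {poly K} :=
  crd u n *: 'X + crd u n.+1 *: (1 + s3_poly n a).

(** Bracketing with e_n lowers the label by one, which multiplies X by z; bracketing with e_(n+1) is
    convolution with the coefficients of 1 + p. *)
Lemma crd_poly_coad (K : fieldType) (n : nat) (a : nat -> K)
    (u x : 'rV[K]_n.+1) :
  eq_upto n.-1 (crd_poly (x *m coad_mx (s3 n a) u))
    (coad_poly a u * crd_poly x).
Proof.
move=> j hj; rewrite coef_crd_poly // mxE.
have hjn : (j < n.+1)%N by lia.
transitivity (\sum_k x 0 k * (crd u n * (k.+1 == j)%:R + crd u n.+1 *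
   ((k == j :> nat)%:R + (if (k.+2 <= j)%N then a (j - k).+1 else 0)))).
  apply: eq_bigr => k _; rewrite mxE -sumrN; congr (_ * _).
  (* The sign in [coad_mx] cancels that of the antisymmetry; the other half of [s3_sc] vanishes
     because [j.+1 < n]. *)
  transitivity (\sum_i u 0 i * s3_rel n a j.+1 i.+1 k.+1).
    apply: eq_bigr => i _; rewrite /= /s3_sc inordK //.
    by rewrite [X in X - _]s3_rel_low ?sub0r ?mulrN ?opprK //; lia.
  under eq_bigr => i _ do rewrite s3_relE // mulrDr !mulrA.
  rewrite big_split /= -!mulr_suml; congr (_ * _ + _ * _).
    rewrite (bigD1 (inord n.-1)) //= eqxx mulr1 big1 ?addr0 // => i /negbTE ->.
    by rewrite mulr0.
  rewrite (bigD1 (inord n)) //= eqxx mulr1 big1 ?addr0 // => i /negbTE ->.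
  by rewrite mulr0.
rewrite /coad_poly mulrDl coefD -!scalerAl !coefZ mulrDl mul1r coefD.
rewrite coefXM (coef_crd_poly _ hj) coefM.
under eq_bigr => k _ do rewrite mulrDr (mulrCA _ (crd u n)) (mulrCA _ (crd u n.+1)).
rewrite big_split /= -!mulr_sumr; congr (_ * _ + _ * _).
  case: j hj hjn => [|j] hj hjn.
    by apply: big1 => k _; rewrite mulr0.
  rewrite coef_crd_poly; last by lia.
  rewrite (bigD1 (inord j)) //= inordK ?eqxx ?mulr1; last by lia.
  rewrite big1 ?addr0 // => k hk; rewrite eqSS; case: eqP => e; rewrite ?mulr0 //.
  by case/eqP: hk; apply: val_inj; rewrite /= inordK ?e //; lia.
under [LHS]eq_bigr => k _ do rewrite mulrDr.
rewrite big_split /=; congr (_ + _).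
  rewrite (bigD1 (inord j)) //= inordK // eqxx mulr1 big1 ?addr0 // => k hk.
  case: eqP => e; rewrite ?mulr0 //.
  by case/eqP: hk; apply: val_inj; rewrite /= inordK ?e //; lia.
rewrite -(big_mkord xpredT (fun i =>
  (s3_poly n a)`_i * (crd_poly x)`_(j - i))).
rewrite big_nat_rev /=.
transitivity (\sum_(0 <= k < n.+1) (if (k.+2 <= j)%N then x 0 (inord k) * a (j - k).+1 else 0)).
  rewrite big_mkord; apply: eq_bigr => k _; rewrite inord_val.
  by case: ifP; rewrite ?mulr0.
rewrite (big_cat_nat (n := j.+1)) //=.
rewrite [X in _ + X]big_nat_cond [X in _ + X]big1 ?addr0; last first.
  by move=> i /andP[/andP[h1 h2] _]; rewrite ifN //; lia.
apply: eq_big_nat => k hk; rewrite add0n subSS coef_s3_poly.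
have -> : (j - (j - k) = k)%N by lia.
rewrite coef_crd_poly; last by lia.
by case: ifP => h1; case: ifP => h2; rewrite ?mul0r 1?mulrC //; lia.
Qed.

(** * Convergence of the matrix exponential *)

Lemma cvg_mx (K : numFieldType) (m n : nat) (T : Type) (F : set_system T)
    {FF : Filter F} (U : T -> 'M[K]_(m, n)) (M : 'M[K]_(m, n)) :
  (forall i j, U x i j @[x --> F] --> M i j) -> U @ F --> M.
Proof.
move=> h S [P MP PS].
have := @filter_forall T 'I_m (fun i => [set x | forall j, P i j (U x i j)]) F FF.
move=> /(_ _)/filterS; apply; first by move=> x hx; apply: PS.
move=> i; apply: (@filter_forall T 'I_n (fun j => [set x | P i j (U x i j)]) F FF).
by move=> j; apply: h (MP i j).
Qed.

Lemma norm_Re_Im_le (R : realType) (z : cplx R) (r : R) : `|z| <= cR r ->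
  `|complex.Re z| <= r /\ `|complex.Im z| <= r.
Proof.
move=> h; split; rewrite -lecR; apply: le_trans h; first exact: normc_ge_Re.
have := normc_ge_Re (z * 'i%C); rewrite ReiNIm normrN => /le_trans; apply.
by rewrite normrM normCi mulr1.
Qed.

Lemma is_cvg_series_cplx (R : realType) (u : nat -> cplx R) (r : R) :
  0 <= r -> (forall k, `|u k| <= cR (r ^+ k / k`!%:R)) ->
  cvg (series u @ \oo).
Proof.
move=> r0 h.
have cv (v : nat -> R) : (forall k, `|v k| <= r ^+ k / k`!%:R) ->
    cvg (series v @ \oo).
  move=> hv; apply: normed_cvg; apply: series_le_cvg (is_cvg_series_exp_coeff r).
  - by move=> k; apply: normr_ge0.
  - by move=> k; rewrite /exp_coeff /= divr_ge0 ?exprn_ge0.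
  - by move=> k; apply: hv.
have /cvg_ex [b hb] := cv _ (fun k => (norm_Re_Im_le (h k)).1).
have /cvg_ex [c hc] := cv _ (fun k => (norm_Re_Im_le (h k)).2).
apply/cvg_ex; exists ((b +i* c)%C : cplx R).
apply: (cvg_cplx (u := series u)).
  rewrite (_ : (fun _ => _) = series (fun k => complex.Re (u k))) //.
  by apply/funext => N; rewrite /series /= raddf_sum.
rewrite (_ : (fun _ => _) = series (fun k => complex.Im (u k))) //.
by apply/funext => N; rewrite /series /= raddf_sum.
Qed.

Lemma norm_mxX_le (K : numFieldType) (n : nat) (A : 'M[K]_n) (c : K) :
  (forall i j, `|A i j| <= c) ->
  forall k i j, `|(A ^+ k) i j| <= (n%:R * c) ^+ k.
Proof.
move=> hc; elim=> [|k IH] i j.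
  by rewrite !expr0 -[1]/(1%:M) mxE; case: eqP => _; rewrite ?normr1 ?normr0.
have c0 : 0 <= c by apply: le_trans (hc i j).
rewrite !exprS -[_ * A ^+ k]/(_ *m _) mxE (le_trans (ler_norm_sum _ _ _)) //.
have -> : n%:R * c * (n%:R * c) ^+ k = \sum_(l < n) c * (n%:R * c) ^+ k.
  by rewrite sumr_const card_ord -mulrA mulr_natl.
by apply: ler_sum => l _; rewrite normrM ler_pM.
Qed.

(** [exp_mx] is a [lim], meaningful only once convergence is known. If the entries of [A] are
    bounded by c, those of A^k are bounded by (N c)^k, so every entry of the series is dominated by
    the series of exp (N c). *)
Lemma cvg_exp_mx (R : realType) (N : nat) (A : 'M[cplx R]_N) :
  series (fun k : nat => (k`!%:R)^-1 *: A ^+ k) @ \oo --> exp_mx A.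
Proof.
have [c [c0 hc]] : exists c : R, 0 <= c /\ forall i j, `|A i j| <= cR c.
  have S0 : 0 <= \sum_ij `|A ij.1 ij.2| by apply: sumr_ge0.
  have [c c0 ec] := cR_ge0P S0.
  exists c; split=> // i j; rewrite -ec (bigD1 (i, j)) //= lerDl.
  by apply: sumr_ge0.
(* By definition [cvg] is convergence to the [lim] itself, here [exp_mx A]. *)
suff : cvg (series (fun k : nat => (k`!%:R)^-1 *: A ^+ k) @ \oo) by [].
pose u i j k : cplx R := (k`!%:R)^-1 * (A ^+ k) i j.
have cu i j : cvg (series (u i j) @ \oo).
  apply: (is_cvg_series_cplx (r := N%:R * c)); first by rewrite mulr_ge0.
  move=> k; rewrite /u normrM normfV normr_nat mulrC /cR.
  rewrite rmorphM fmorphV rmorphXn rmorphM !rmorph_nat ler_wpM2r ?invr_ge0 //.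
  exact: norm_mxX_le.
apply/cvg_ex; exists (\matrix_(i, j) lim (series (u i j) @ \oo)).
apply: cvg_mx => i j; rewrite mxE.
rewrite (_ : (fun _ => _) = series (u i j)); first exact: cu.
apply/funext => K; rewrite /series /= summxE; apply: eq_bigr => k _.
by rewrite mxE.
Qed.

Lemma cvg_finite_sum (K : numFieldType) (T I : Type) (F : set_system T)
    {FF : Filter F} (s : seq I) (f : T -> I -> K) (l : I -> K) :
  (forall i, f x i @[x --> F] --> l i) ->
  \sum_(i <- s) f x i @[x --> F] --> \sum_(i <- s) l i.
Proof.
move=> h; elim: s => [|i s IH].
  by under eq_fun do rewrite big_nil; rewrite big_nil; apply: cvg_cst.
under eq_fun do rewrite big_cons; rewrite big_cons.
exact: (cvgD (h i) IH).
Qed.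

Lemma cvg_row_exp_mx (R : realType) (N : nat) (A : 'M[cplx R]_N)
    (x : 'rV[cplx R]_N) (j : 'I_N) :
  (x *m \sum_(k < M) (k`!%:R)^-1 *: A ^+ k) 0 j @[M --> \oo] -->
  (x *m exp_mx A) 0 j.
Proof.
have := @cvg_exp_mx R N A; rewrite /series /=.
set S := (fun M => _); set E := exp_mx A => h.
rewrite (_ : (fun _ => _) = fun M => \sum_i x 0 i * S M i j); last first.
  by apply/funext => M; rewrite mxE /S; under [RHS]eq_bigr do rewrite big_mkord.
rewrite mxE.
have hS i : S M i j @[M --> \oo] --> E i j.
  exact: cvg_comp h (@coord_continuous _ _ _ i j E).
apply: cvg_finite_sum => i.
exact: (cvgM (cvg_cst (x 0 i)) (hS i)).
Qed.

(** * From the infinitesimal action to the group action *)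

Lemma coad_polyE (K : fieldType) (n : nat) (a : nat -> K) (u : 'rV[K]_n.+1) :
  coad_poly a u =
  crd u n *: 'X + crd u n.+1 *: s3_poly n a + (crd u n.+1)%:P.
Proof.
by rewrite /coad_poly scalerDr alg_polyC (addrC _%:P) addrA.
Qed.

Lemma crd_poly_coadX (K : fieldType) (n : nat) (a : nat -> K)
    (u x : 'rV[K]_n.+1) (k : nat) :
  eq_upto n.-1 (crd_poly (x *m coad_mx (s3 n a) u ^+ k))
    (coad_poly a u ^+ k * crd_poly x).
Proof.
elim: k => [|k IH] i hi; first by rewrite !expr0 mul1r mulmx1.
rewrite exprSr -[_ ^+ k * _]/(_ *m _) mulmxA crd_poly_coad // exprS -mulrA.
by apply: eq_upto_mul IH _ hi => // j.
Qed.

Lemma crd_poly_exp_coad (K : numFieldType) (n : nat) (a : nat -> K)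
    (u x : 'rV[K]_n.+1) (M : nat) :
  eq_upto n.-1
    (crd_poly (x *m \sum_(k < M) (k`!%:R)^-1 *: coad_mx (s3 n a) u ^+ k))
    (exp_trunc M (coad_poly a u) * crd_poly x).
Proof.
move=> i hi; rewrite coef_crd_poly // mulmx_sumr summxE /exp_trunc mulr_suml.
rewrite coef_sum; apply: eq_bigr => k _.
rewrite poly_div_nat -scalerAl coefZ -scalemxAr mxE; congr (_ * _).
by rewrite -crd_poly_coadX // coef_crd_poly.
Qed.

Lemma exp_trunc_polyC (K : numFieldType) (M : nat) (c : K) :
  exp_trunc M c%:P = (exp_trunc M c)%:P.
Proof.
rewrite /exp_trunc rmorph_sum; apply: eq_bigr => k _.
by rewrite poly_div_nat rmorphM rmorphXn mulrC mul_polyC.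
Qed.

(** As X^i divides q^i, only the powers with [i < d] reach the coefficient [j]. The order [M] is
    thereby confined to finitely many scalar factors, and can tend to infinity. *)
Lemma coef_exp_trunc_addC (K : numFieldType) (d M : nat) (t : K)
    (q X : {poly K}) (j : nat) :
  q`_0 = 0 -> (j < d)%N -> (d <= M)%N ->
  (exp_trunc M (q + t%:P) * X)`_j =
  \sum_(i < d) exp_trunc (M - i) t * (q ^+ i / i`!%:R * X)`_j.
Proof.
move=> q0 jd dM; rewrite (exp_truncD _ _ _ (@unit_natr_poly K)).
transitivity (\sum_(0 <= i < M) exp_trunc (M - i) t * (q ^+ i / i`!%:R * X)`_j).
  rewrite mulr_suml coef_sum big_mkord; apply: eq_bigr => i _.
  by rewrite exp_trunc_polyC mulrAC (mulrC _ (exp_trunc _ _)%:P) mul_polyC coefZ.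
rewrite (big_cat_nat (n := d)) //= big_mkord [X in _ + X]big_nat_cond.
rewrite [X in _ + X]big1 ?addr0 // => i /andP[/andP[di _] _].
rewrite poly_div_nat -scalerAl coefZ coefM big1 ?mulr0 // => l _.
rewrite -[q ^+ i]mulr1 -(expr0 q) coef_exprM_low ?mul0r // addn0.
by have := ltn_ord l; lia.
Qed.

Lemma crd_poly_coadjoint_exp (R : realType) (n : nat) (a : nat -> cplx R)
    (u x : 'rV[cplx R]_n.+1) :
  eq_upto n.-1 (crd_poly (coadjoint_exp (s3 n a) u x))
    (cexp (crd u n.+1) *: (exp_trunc n.-1
        (crd u n *: 'X + crd u n.+1 *: s3_poly n a) * crd_poly x)).
Proof.
move=> j hj; rewrite coef_crd_poly // /coadjoint_exp.
set q := _ *: 'X + _; set t := crd u n.+1.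
have q0 : q`_0 = 0 by rewrite coefD !coefZ coefX coef_s3_poly !mulr0 addr0.
have eq_q : coad_poly a u = q + t%:P by exact: coad_polyE.
pose c i := (q ^+ i / i`!%:R * crd_poly x)`_j.
have h : (x *m \sum_(k < M) (k`!%:R)^-1 *: coad_mx (s3 n a) u ^+ k) 0 (inord j)
    @[M --> \oo] --> \sum_(i < n.-1) cexp t * c i.
  have : \sum_(i < n.-1) exp_trunc (M - i) t * c i @[M --> \oo] -->
      \sum_(i < n.-1) cexp t * c i.
    apply: cvg_finite_sum => i.
    apply: (cvgM _ (cvg_cst (c i))).
    by rewrite (cvg_centern i (fun M => exp_trunc M t)); apply: cvg_exp_trunc.
  apply: cvg_trans; apply: near_eq_cvg.
  (* The two sequences agree only from [n.-1] on, the range of [coef_exp_trunc_addC]. *)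
  exists n.-1 => //= M hM.
  by rewrite -coef_crd_poly // crd_poly_exp_coad // eq_q (coef_exp_trunc_addC _ _ q0 hj hM).
transitivity (\sum_(i < n.-1) cexp t * c i).
  have h' := @cvg_row_exp_mx R n.+1 (coad_mx (s3 n a) u) x (inord j).
  rewrite -(cvg_lim (@norm_hausdorff _ _) h).
  by rewrite -(cvg_lim (@norm_hausdorff _ _) h').
by rewrite coefZ -mulr_sumr /exp_trunc mulr_suml coef_sum.
Qed.

(** * The invariants as coefficients *)

(** In the expanded power, the choice s_1, ..., s_i contributes in degree (s_1 - 1) + ... + (s_i -
    1), which is m exactly when the s_t add up to m + i. *)
Lemma coef_s3_polyX (K : fieldType) (n : nat) (a : nat -> K) (i m : nat) :
  (s3_poly n a ^+ i)`_m = s3_b n a m i.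
Proof.
rewrite /s3_b -{1}(card_ord i) -prodr_const /s3_poly bigA_distr_big.
rewrite coef_sum.
rewrite (bigID (fun f : {ffun 'I_i -> 'I_n} => (\sum_t f t)%N == (m + i)%N)) /=.
have E (f : {ffun 'I_i -> 'I_n}) : f \in ffun_on (fun s : 'I_n => (3 <= s)%N) ->
    (\prod_t (a (f t) *: 'X^((f t).-1)))`_m =
    (\prod_t a (f t)) * ((\sum_t f t)%N == (m + i)%N)%:R.
  move=> /ffun_onP hf; rewrite scaler_prod prodrXr coefZ coefXn.
  congr (_ * (_)%:R); congr nat_of_bool.
  have -> : (\sum_t f t = \sum_t (f t).-1 + i)%N.
    rewrite -[X in (_ + X)%N](card_ord i) -sum1_card -big_split /=.
    apply: eq_bigr => t _; have := hf t; rewrite unfold_in.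
    by case: (nat_of_ord (f t)) => // v _; rewrite [RHS]addn1.
  by rewrite eqn_add2r eq_sym.
rewrite [X in _ + X]big1 ?addr0; last first.
  by move=> f /andP[hf /negbTE h]; rewrite E // h mulr0.
apply: eq_big => [f|f /andP[hf h]]; last by rewrite E // h mulr1.
congr (_ && _); apply/ffun_onP/forallP => h t; have := h t; by rewrite inE.
Qed.

(** Each s_t is at least 3, so 3 i <= m + i. Hence stopping at i = [m/2] loses no term of the
    exponential. *)
Lemma s3_b_eq0 (K : fieldType) (n : nat) (a : nat -> K) (m i : nat) :
  (m./2 < i)%N -> s3_b n a m i = 0.
Proof.
move=> hi; rewrite /s3_b big_pred0 // => f; apply/negbTE/negP.
move=> /andP[/forallP h /eqP e].
have : (\sum_(t < i) 3 <= \sum_(t < i) f t)%N by apply: leq_sum => t _.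
by rewrite sum_nat_const card_ord e; lia.
Qed.

Lemma coef_exp_trunc_s3_poly (K : numFieldType) (n d : nat) (a : nat -> K)
    (c : K) (m : nat) : (m < d)%N ->
  (exp_trunc d (c *: s3_poly n a))`_m =
  if m == 0%N then 1
  else \sum_(1 <= i < (m./2).+1) s3_b n a m i / i`!%:R * c ^+ i.
Proof.
case: eqP => [->|/eqP m0] md.
  by rewrite coef0_exp_trunc // coefZ coef_s3_poly mulr0.
rewrite /exp_trunc coef_sum.
transitivity (\sum_(0 <= i < d) s3_b n a m i / i`!%:R * c ^+ i).
  rewrite big_mkord; apply: eq_bigr => i _.
  by rewrite poly_div_nat exprZn !coefZ coef_s3_polyX; ring.
rewrite (big_cat_nat (n := (m./2).+1)) //=; last by lia.
rewrite [X in _ + X]big_nat_cond [X in _ + X]big1 ?addr0; last first.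
  by move=> i /andP[/andP[h1 h2] _]; rewrite s3_b_eq0 ?mul0r.
rewrite big_ltn // expr0 fact0 divr1 mulr1.
suff -> : s3_b n a m 0 = 0 by rewrite add0r.
by rewrite -coef_s3_polyX expr0 coef1 (negbTE m0).
Qed.

Lemma coef_exp_trunc_X (K : numFieldType) (d : nat) (c : K) (m : nat) :
  (m < d)%N -> (exp_trunc d (c *: 'X))`_m = c ^+ m / m`!%:R.
Proof.
move=> md; rewrite /exp_trunc coef_sum (bigD1 (Ordinal md)) //=.
rewrite poly_div_nat exprZn !coefZ coefXn eqxx mulr1 mulrC big1 ?addr0 // => i hi.
rewrite poly_div_nat exprZn !coefZ coefXn; case: eqP => e; rewrite ?mulr0 //.
by case/eqP: hi; apply: val_inj.
Qed.

(** For l >= 3 this collects the powers of x_1 in xi_l. For l = 1 the coefficient is x_1, whence the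
    value 1; for l = 2 it is x_2 - (x_2 / x_1) x_1 = 0. *)
Lemma s3_xi_factorE (K : numFieldType) (n : nat) (x : 'rV[K]_n.+1) (l : nat) :
  (1 <= l <= n.-1)%N -> crd x 1 != 0 ->
  s3_xi_factor x l = (crd x 1)^-1 *
    (exp_trunc n.-1 ((- (crd x 2 / crd x 1)) *: 'X) * crd_poly x)`_l.-1.
Proof.
move=> /andP[l1 ln] x1.
have -> : (exp_trunc n.-1 ((- (crd x 2 / crd x 1)) *: 'X) * crd_poly x)`_l.-1 =
  \sum_(1 <= j < l.+1) (- (crd x 2 / crd x 1)) ^+ (l - j) / (l - j)`!%:R * crd x j.
  rewrite coefMr prednK // big_add1 /= big_mkord; apply: eq_bigr => i _.
  have il := ltn_ord i; rewrite coef_exp_trunc_X; last by lia.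
  rewrite coef_poly (_ : (i < n.-1)%N = true); last by lia.
  by rewrite (_ : (l.-1 - i = l - i.+1)%N) //; lia.
rewrite /s3_xi_factor; case: eqP => [->|/eqP n1].
  by rewrite big_nat1 subnn expr0 fact0 divr1 mul1r mulVf.
rewrite /s3_xi /= (negbTE n1); case: eqP => [->|/eqP n2].
  rewrite mulr0 big_ltn // big_nat1 subnn expr0 fact0 divr1 mul1r.
  by rewrite expr1; field.
rewrite !mulr_sumr; apply: eq_big_nat => j /andP[j1 jl].
(* The integer powers of x_1 are split so as to leave two mutually inverse ones, which [field] then
   sees as variables [A] and [B]. *)
have -> : crd x 1 ^ (1 - l%:Z) = (crd x 1)^-1 * crd x 1 * (crd x 1)^-1 ^+ (l - j) * crd x 1 ^ (1 - j%:Z).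
  rewrite mulVf // mul1r exprVn exprnN -expfzDr //; congr (_ ^ _); lia.
have -> : crd x 1 ^ (j%:Z - 2) = (crd x 1)^-1 * crd x 1 ^ (j%:Z - 1).
  by rewrite -exprN1 -expfzDr //; congr (_ ^ _); lia.
have h : crd x 1 ^ (1 - j%:Z) * crd x 1 ^ (j%:Z - 1) = 1.
  by rewrite -expfzDr // (_ : _ + _ = 0) //; lia.
rewrite [(- (crd x 2 / crd x 1)) ^+ _]exprNn exprMn.
move: (crd x 1 ^ (1 - j%:Z)) (crd x 1 ^ (j%:Z - 1)) h => A B h.
rewrite -[RHS]mulr1 -[X in _ = _ * X]h.
have fn0 : (l - j)`!%:R != 0 :> K by rewrite pnatr_eq0 -lt0n fact_gt0.
move: ((-1) ^+ (l - j)) (crd x 2 ^+ (l - j)) ((crd x 1)^-1 ^+ (l - j)) => u v w.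
by field; rewrite x1 fn0.
Qed.

Definition s3_arg (R : realType) (n : nat) (a : nat -> cplx R)
    (L : cplx R -> cplx R) (x : 'rV[cplx R]_n.+1) : {poly cplx R} :=
  L (crd x 1) *: s3_poly n a + (crd x 2 / crd x 1) *: 'X.

Lemma coef0_s3_arg (R : realType) (n : nat) (a : nat -> cplx R)
    (L : cplx R -> cplx R) (x : 'rV[cplx R]_n.+1) : (s3_arg a L x)`_0 = 0.
Proof. by rewrite coefD !coefZ coef_s3_poly coefX !mulr0 addr0. Qed.

(** exp (- [s3_arg]) splits into exp (- (ln x_1) p) and exp (- (x_2 / x_1) z). The sum over m is the
    convolution of the coefficients of the first with the factors of label k - m, which absorb the
    second. *)
Lemma s3_casimirE (R : realType) (n : nat) (a : nat -> cplx R)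
    (L : cplx R -> cplx R) (k : nat) (x : 'rV[cplx R]_n.+1) :
  (3 <= k <= n.-1)%N -> crd x 1 != 0 ->
  s3_casimir a L k x = (crd x 1)^-1 *
    (exp_trunc n.-1 (- s3_arg a L x) * crd_poly x)`_k.-1.
Proof.
move=> /andP[k3 kn] x1; have kk : (k.-1 < n.-1)%N by lia.
have q0 : ((- L (crd x 1)) *: s3_poly n a)`_0 = 0.
  by rewrite coefZ coef_s3_poly mulr0.
have r0 : ((- (crd x 2 / crd x 1)) *: 'X : {poly cplx R})`_0 = 0.
  by rewrite coefZ coefX mulr0.
have := eq_upto_mul (exp_trunc_mul_upto (d := n.-1) q0 r0)
  ((fun i _ => erefl) : eq_upto n.-1 (crd_poly x) (crd_poly x)) kk.
have <- : - s3_arg a L x = - L (crd x 1) *: s3_poly n a +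
    (- (crd x 2 / crd x 1)) *: 'X by rewrite !scaleNr -opprD.
move=> <-; rewrite -mulrA coefM mulr_sumr /s3_casimir prednK //; last by lia.
rewrite -(big_mkord xpredT (fun m => (crd x 1)^-1 * ((exp_trunc n.-1 (- L (crd x 1) *: s3_poly n a))`_m *
   (exp_trunc n.-1 (- (crd x 2 / crd x 1) *: 'X) * crd_poly x)`_(k.-1 - m)))).
(* The term m = 0 is the leading factor; the term m = 1 vanishes, since p starts in degree 2. *)
rewrite big_ltn; last by lia.
rewrite big_ltn; last by lia.
have h0 : (0 < n.-1)%N by lia.
have h1 : (1 < n.-1)%N by lia.
rewrite (coef_exp_trunc_s3_poly _ _ _ h0) (coef_exp_trunc_s3_poly _ _ _ h1) /=.
rewrite [\sum_(1 <= i < 1) _]big_geq //.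
rewrite mul0r mulr0 add0r mul1r subn0 s3_xi_factorE //; last by lia.
congr (_ + _); apply: eq_big_nat => m /andP[m2 mk].
rewrite coef_exp_trunc_s3_poly; last by lia.
rewrite (_ : (m == 0%N) = false); last by lia.
rewrite s3_xi_factorE //; last by lia.
rewrite (_ : ((k - m).-1 = k.-1 - m)%N); last by lia.
by rewrite mulrAC mulrA.
Qed.

(** * The number of invariants *)

Lemma mxrank_mxsub_le (K : fieldType) (m n p q : nat) (f : 'I_p -> 'I_m)
    (g : 'I_q -> 'I_n) (A : 'M[K]_(m, n)) : (\rank (mxsub f g A) <= \rank A)%N.
Proof.
have -> : mxsub f g A = rowsub f 1%:M *m A *m colsub g 1%:M.
  by rewrite mul_rowsub_mx mul1mx mulmx_colsub mulmx1; apply/matrixP => i j; rewrite !mxE.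
by apply: leq_trans (mxrankM_maxl _ _) (mxrankM_maxr _ _).
Qed.

(** With [D] the projection onto the last two coordinates, A = D A + (A - D A) D, and both summands
    have rank at most 2. *)
Lemma mxrank_border2 (K : fieldType) (n : nat) (A : 'M[K]_n.+2) :
  (forall i j : 'I_n.+2, (i < n)%N -> (j < n)%N -> A i j = 0) ->
  (\rank A <= 4)%N.
Proof.
move=> A0; pose p : 'I_n.+2 := inord n; pose q : 'I_n.+2 := inord n.+1.
pose D : 'M[K]_n.+2 := delta_mx p p + delta_mx q q.
have rD : (\rank D <= 2)%N.
  by rewrite (leq_trans (mxrank_add _ _)) // !mxrank_delta.
have ED : D = diag_mx (\row_i (n <= i)%N%:R).
  apply/matrixP => i j; rewrite !mxE -!val_eqE /= !inordK //.
  rewrite -natrD -mulrnA; congr (_%:R).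
  have := ltn_ord i; have := ltn_ord j.
  move: (nat_of_ord i) (nat_of_ord j) => k l hk hl.
  by case: (leqP n l) => h; do ![case: eqP => ? //=]; lia.
have -> : A = D *m A + (A - D *m A) *m D.
  apply/matrixP => i j; rewrite ED mul_mx_diag mul_diag_mx !mxE.
  have [_|hi] := leqP n i; first by rewrite mul1r subrr mul0r addr0.
  have [_|hj] := leqP n j; first by rewrite mulr0n mul0r subr0 mulr1 add0r.
  by rewrite A0 // ?(mulr0n, mulr0, addr0).
rewrite (leq_trans (mxrank_add _ _)) // (leq_add (n1 := 2) (n2 := 2)) //.
  exact: leq_trans (mxrankM_maxl _ _) rD.
exact: leq_trans (mxrankM_maxr _ _) rD.
Qed.

(** The square of [B] is -1, so [B] is invertible. *)
Lemma mxrank_antidiag (K : fieldType) (B : 'M[K]_4) :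
  (forall i j : 'I_4, B i j =
     if (i + j == 3)%N then (-1) ^+ (2 <= i)%N else 0) -> \rank B = 4%N.
Proof.
move=> hB; apply/eqP; rewrite eqn_leq rank_leq_row /=.
have BB : B *m B = (-1)%:M.
  apply/matrixP => i j; rewrite !mxE !big_ord_recl big_ord0 !hB.
  by case: i => -[|[|[|[|]]]] //= hi; case: j => -[|[|[|[|]]]] //= hj;
    rewrite ?mulr0 ?mul0r ?expr0 ?expr1 ?mul1r ?mulr1 ?add0r ?addr0 ?mulr1n ?mulr0n.
by rewrite -{1}(@mxrank_unit K 4 (-1)%:M) -?BB ?mxrankM_maxl // BB unitmxE det_scalar unitrX // unitrN1.
Qed.

Lemma s3_rank_le4 (K : fieldType) (n : nat) (a : nat -> K) (x : 'rV[K]_n.+1) :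
  (1 <= n)%N -> (\rank (commutator_mx (s3 n a) x) <= 4)%N.
Proof.
case: n a x => // n a x _; apply: mxrank_border2 => i j hi hj.
rewrite mxE big1 // => k _.
by rewrite /= /s3_sc !s3_rel_low ?subrr ?mul0r.
Qed.

(** At this point the matrix records the e_1-components of the brackets. On the labels 1, 2, n, n +
    1 only [e_1, e_(n+1)] = [e_2, e_n] = e_1 and their opposites contribute, which gives an
    antidiagonal minor. *)
Lemma s3_rank_eq4 (K : fieldType) (n : nat) (a : nat -> K) : (4 <= n)%N ->
  \rank (commutator_mx (s3 n a) (delta_mx 0 0)) = 4%N.
Proof.
move=> hn; apply/eqP; rewrite eqn_leq s3_rank_le4 //=; last by lia.
pose f (t : 'I_4) : 'I_n.+1 := inord (nth 0%N [:: 0%N; 1%N; n.-1; n] t).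
rewrite -(@mxrank_antidiag K (mxsub f f (commutator_mx (s3 n a) (delta_mx 0 0)))).
  exact: mxrank_mxsub_le.
have E i j : commutator_mx (s3 n a) (delta_mx 0 0) i j = s3_sc a i j 0.
  rewrite mxE (bigD1 0) //= mxE !eqxx mulr1 big1 ?addr0 // => k /negbTE hk.
  by rewrite mxE hk andbF mulr0.
move=> i j; rewrite mxE E /s3_sc /f.
have e0 : (inord 0 : 'I_n.+1) = 0%N :> nat by rewrite inordK.
have e1 : (inord 1 : 'I_n.+1) = 1%N :> nat by rewrite inordK //; lia.
have e2 : (inord n.-1 : 'I_n.+1) = n.-1 :> nat by rewrite inordK //; lia.
have e3 : (inord n : 'I_n.+1) = n :> nat by rewrite inordK //; lia.
have n1 : n.-1.+1 = n by lia.
have f1 : (n.+1 == n) = false by lia.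
have f2 : (n <= n.-1)%N = false by lia.
have f3 : (n < n.-1)%N = false by lia.
have f4 : (n == n.+1) = false by lia.
have f5 : (1 < n.-1)%N = true by lia.
have f6 : (0 < n.-1)%N = true by lia.
have g1 : (1 == n)%N = false by lia.
have g2 : (2 == n)%N = false by lia.
have g3 : (1 == n.+1)%N = false by lia.
have g4 : (2 == n.+1)%N = false by lia.
by case: i => -[|[|[|[|]]]] //= hi; case: j => -[|[|[|[|]]]] //= hj;
  rewrite ?e0 ?e1 ?e2 ?e3 /s3_rel ?n1 ?eqxx ?f1 ?f2 ?f3 ?f4 ?f5 ?f6 ?g1 ?g2
   ?g3 ?g4 /= ?andbF /= ?eqxx ?subr0 ?sub0r ?oppr0 ?addr0 ?expr1 ?expr0
   ?(eqxx, subrr, sub0r, oppr0, addr0).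
Qed.

Lemma s3_num_invariants (K : fieldType) (n : nat) (a : nat -> K) : (4 <= n)%N ->
  num_invariants (s3 n a) = (n - 3)%N.
Proof.
move=> hn; rewrite /num_invariants /sup_rank.
suff -> : (\max_(r < n.+2 | `[< exists x, \rank (commutator_mx (s3 n a) x) = r >]) r = 4)%N.
  by lia.
apply/eqP; rewrite eqn_leq; apply/andP; split.
  apply/bigmax_leqP => r /asboolP [x <-].
  by apply: s3_rank_le4; lia.
have h4 : (4 < n.+2)%N by lia.
apply: (@leq_bigmax_cond _ _ _ (Ordinal h4)); apply/asboolP.
by exists (delta_mx 0 0); apply: s3_rank_eq4.
Qed.

(** * Invariance *)

Lemma differentiable_bigsum (K : numFieldType) (V : normedModType K) (I : Type)
    (s : seq I) (f : I -> V -> K) (x : V) :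
  (forall i, differentiable (f i) x) ->
  differentiable (fun y => \sum_(i <- s) f i y) x.
Proof.
move=> h; elim: s => [|i s IH].
  by under eq_fun do rewrite big_nil; apply: differentiable_cst.
by under eq_fun do rewrite big_cons; apply: differentiableD.
Qed.

Lemma differentiable_expn (K : numFieldType) (V : normedModType K)
    (f : V -> K) (m : nat) (x : V) :
  differentiable f x -> differentiable (fun y => f y ^+ m) x.
Proof.
case: m => [|m] df; first exact: differentiable_cst.
by have := @differentiableX _ _ f m x df; rewrite exprfctE.
Qed.

Lemma differentiable_expz (K : numFieldType) (V : normedModType K)
    (f : V -> K) (m : int) (x : V) :
  differentiable f x -> f x != 0 -> differentiable (fun y => f y ^ m) x.
Proof.
move=> df fx; case: m => m; first exact: differentiable_expn.
apply: (differentiableV (f := fun y => f y ^+ m.+1)).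
  exact: differentiable_expn.
by rewrite expf_neq0.
Qed.

Lemma differentiable_crd (K : numFieldType) (n : nat) (k : nat)
    (x : 'rV[K]_n.+1) : differentiable (fun y : 'rV[K]_n.+1 => crd y k) x.
Proof. exact: differentiable_coord. Qed.

Lemma differentiable_s3_xi_factor (K : numFieldType) (n l : nat)
    (x : 'rV[K]_n.+1) : crd x 1 != 0 ->
  differentiable (fun y : 'rV[K]_n.+1 => s3_xi_factor y l) x.
Proof.
move=> x1; rewrite /s3_xi_factor; case: eqP => _.
  exact: differentiable_cst.
apply: (differentiableM (f := fun y : 'rV[K]_n.+1 => crd y 1 ^ (1 - l%:Z))).
  by apply: differentiable_expz => //; apply: differentiable_crd.
rewrite /s3_xi; case: eqP => _; first exact: differentiable_crd.
case: eqP => _; first exact: differentiable_cst.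
apply: differentiable_bigsum => j.
apply: (differentiableM (f := fun y : 'rV[K]_n.+1 => _ * _ * _)); last first.
  exact: differentiable_crd.
apply: (differentiableM (f := fun y : 'rV[K]_n.+1 => _ * _)); last first.
  by apply: differentiable_expn; apply: differentiable_crd.
apply: (differentiableM (f := fun y : 'rV[K]_n.+1 => _)).
  exact: differentiable_cst.
by apply: differentiable_expz => //; apply: differentiable_crd.
Qed.

Lemma differentiable_s3_casimir (R : realType) (n k : nat) (a : nat -> cplx R)
    (D : set (cplx R)) (L : cplx R -> cplx R) (x : 'rV[cplx R]_n.+1) :
  log_branch D L -> D (crd x 1) -> differentiable (s3_casimir a L k) x.
Proof.
move=> LB Dx; have x1 := log_branch_neq0 LB Dx.
apply: (differentiableD (f := fun y => s3_xi_factor y k)).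
  exact: differentiable_s3_xi_factor.
apply: differentiable_bigsum => m.
apply: (differentiableM (f := fun y => s3_xi_factor y (k - m)%N)).
  exact: differentiable_s3_xi_factor.
apply: differentiable_bigsum => i.
apply: (differentiableM (f := fun y => _)); first exact: differentiable_cst.
apply: differentiable_expn.
apply: (differentiableN (f := fun y : 'rV[cplx R]_n.+1 => L (crd y 1))).
apply: (differentiable_comp (f := fun y : 'rV[cplx R]_n.+1 => crd y 1)).
  exact: differentiable_crd.
exact: log_branch_differentiable LB Dx.
Qed.

Lemma eq_upto_refl (K : fieldType) (d : nat) (p : {poly K}) : eq_upto d p p.
Proof. by []. Qed.

Lemma exp_trunc_cancel (K : numFieldType) (d : nat) (q X : {poly K}) :
  q`_0 = 0 -> eq_upto d (exp_trunc d q * (exp_trunc d (- q) * X)) X.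
Proof.
move=> q0 j jd.
have := eq_upto_mul (exp_trunc_inv_upto q0) (@eq_upto_refl _ d X) jd.
by rewrite mul1r -mulrA.
Qed.

Lemma coef1_s3_arg (R : realType) (n : nat) (a : nat -> cplx R)
    (L : cplx R -> cplx R) (x : 'rV[cplx R]_n.+1) :
  (s3_arg a L x)`_1 = crd x 2 / crd x 1.
Proof. by rewrite coefD !coefZ coef_s3_poly coefX /= mulr0 add0r mulr1. Qed.

Lemma coef0_exp_truncM (K : numFieldType) (d : nat) (q X : {poly K}) :
  q`_0 = 0 -> (0 < d)%N -> (exp_trunc d q * X)`_0 = X`_0.
Proof. by move=> q0 d0; rewrite coefM big_ord1 coef0_exp_trunc ?mul1r. Qed.

Lemma coef1_exp_truncM (K : numFieldType) (d : nat) (q X : {poly K}) :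
  q`_0 = 0 -> (1 < d)%N -> (exp_trunc d q * X)`_1 = X`_1 + q`_1 * X`_0.
Proof.
move=> q0 d1; rewrite coefM big_ord_recl big_ord1 /= coef0_exp_trunc ?mul1r //.
  by rewrite coef1_exp_trunc.
exact: ltnW.
Qed.

Lemma crd1_crd_poly (K : fieldType) (n : nat) (x : 'rV[K]_n.+1) :
  (1 < n)%N -> crd x 1 = (crd_poly x)`_0.
Proof. by case: n x => [|[|n]] x // _; rewrite coef_crd_poly. Qed.

Lemma crd2_crd_poly (K : fieldType) (n : nat) (x : 'rV[K]_n.+1) :
  (2 < n)%N -> crd x 2 = (crd_poly x)`_1.
Proof. by case: n x => [|[|[|n]]] x // _; rewrite coef_crd_poly. Qed.

(** The action multiplies X by e^t exp q and x_1 by e^t, and adds u_n to x_2 / x_1; with the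
    hypothesis on [L], it adds exactly q to [s3_arg]. So exp (- [s3_arg]) absorbs exp q, and e^t
    cancels against the factor 1 / x_1. *)
Lemma s3_casimir_coadjoint_exp (R : realType) (n k : nat) (a : nat -> cplx R)
    (L : cplx R -> cplx R) (u x : 'rV[cplx R]_n.+1) :
  (3 <= k <= n.-1)%N -> crd x 1 != 0 ->
  L (cexp (crd u n.+1) * crd x 1) = L (crd x 1) + crd u n.+1 ->
  s3_casimir a L k (coadjoint_exp (s3 n a) u x) = s3_casimir a L k x.
Proof.
move=> hk x1 hL; set y := coadjoint_exp _ u x; set t := crd u n.+1 in hL.
have := @crd_poly_coadjoint_exp R n a u x; rewrite -/y -/t.
set q := crd u n *: 'X + _ => hy.
have n2 : (2 < n)%N by lia.
have q0 : q`_0 = 0 by rewrite coefD !coefZ coefX coef_s3_poly !mulr0 addr0.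
have q1 : q`_1 = crd u n by rewrite coefD !coefZ coefX coef_s3_poly mulr0 addr0 mulr1.
have y1 : crd y 1 = cexp t * crd x 1.
  rewrite crd1_crd_poly ?(ltnW n2) // hy ?coefZ ?coef0_exp_truncM //; last 2 first.
  - by lia.
  - by lia.
  by rewrite -crd1_crd_poly // ltnW.
have y2 : crd y 2 = cexp t * (crd x 2 + crd u n * crd x 1).
  rewrite crd2_crd_poly // hy ?coefZ ?coef1_exp_truncM //; last 2 first.
  - by lia.
  - by lia.
  by rewrite -crd1_crd_poly ?(ltnW n2) // -crd2_crd_poly // q1.
have e0 := cexp_neq0 t.
have argy : s3_arg a L y = s3_arg a L x + q.
  rewrite /s3_arg y1 hL y2.
  have -> : cexp t * (crd x 2 + crd u n * crd x 1) / (cexp t * crd x 1) =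
      crd x 2 / crd x 1 + crd u n.
    by rewrite -mulf_div divff // mul1r mulrDl mulfK.
  by rewrite !scalerDl /q addrACA [X in _ + X = _]addrC.
have y10 : crd y 1 != 0 by rewrite y1 mulf_neq0.
rewrite !s3_casimirE // argy.
have kk : (k.-1 < n.-1)%N by lia.
have -> : (exp_trunc n.-1 (- (s3_arg a L x + q)) * crd_poly y)`_k.-1 =
    cexp t * (exp_trunc n.-1 (- s3_arg a L x) * crd_poly x)`_k.-1.
  have h1 := eq_upto_mul (@eq_upto_refl _ n.-1
    (exp_trunc n.-1 (- (s3_arg a L x + q)))) hy.
  rewrite h1 // -scalerAr coefZ mulrA; congr (_ * _).
  have r0 : (- (s3_arg a L x + q))`_0 = 0.
    by rewrite coefN coefD coef0_s3_arg q0 addr0 oppr0.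
  have h2 := exp_trunc_mul_upto (d := n.-1) r0 q0.
  rewrite (eq_upto_mul h2 (@eq_upto_refl _ n.-1 (crd_poly x)) kk).
  by rewrite opprD subrK.
by rewrite y1 invfM mulrACA mulVf // mul1r.
Qed.

Lemma s3_coadjoint_invariant (R : realType) (n k : nat) (a : nat -> cplx R)
    (D : set (cplx R)) (L : cplx R -> cplx R) :
  (3 <= k <= n.-1)%N -> log_branch D L ->
  coadjoint_invariant (s3 n a) [set x | D (crd x 1)] (s3_casimir a L k).
Proof.
move=> hk LB; split.
- case: (LB) => oD _ _; rewrite -[[set x | _]]/((fun x => crd x 1) @^-1` D).
  by apply: open_comp oD => x _; apply: coord_continuous.
- by move=> x Dx; apply: differentiable_s3_casimir LB Dx.
move=> x Dx.
have c0 : (fun u : 'rV[cplx R]_n.+1 => crd u n.+1) @ (0 : 'rV[cplx R]_n.+1) --> (0 : cplx R).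
  have := @coord_continuous (cplx R) 1 n.+1 0 (inord n) (0 : 'rV[cplx R]_n.+1).
  by rewrite /continuous_at mxE.
have h : \forall u \near (0 : 'rV[cplx R]_n.+1),
    D (cexp (crd u n.+1) * crd x 1) /\
    L (cexp (crd u n.+1) * crd x 1) = L (crd x 1) + crd u n.+1.
  exact: c0 (log_branch_mul_cexp LB Dx).
near=> u; have [_ hu] : D (cexp (crd u n.+1) * crd x 1) /\
    L (cexp (crd u n.+1) * crd x 1) = L (crd x 1) + crd u n.+1 by near: u.
exact: s3_casimir_coadjoint_exp hk (log_branch_neq0 LB Dx) hu.
Unshelve. all: by end_near. Qed.

(** * Functional independence *)

(** What exp (- [s3_arg]) X / x_1 must be modulo z^(n-1) at a point with invariants [y] (for r = n -
    3): its coefficients in degrees 0 and 1 are always 1 and 0, and the invariant of label [k + 3]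
    sits in degree [k.+2]. *)
Definition invariants_poly (K : fieldType) (r : nat) (y : 'rV[K]_r) :
  {poly K} := 1 + \sum_(k < r) y 0 k *: 'X^(k.+2).

Lemma coef_invariants_poly (K : fieldType) (r : nat) (y : 'rV[K]_r) (k : 'I_r) :
  (invariants_poly y)`_k.+2 = y 0 k.
Proof.
rewrite coefD coef1 add0r coef_sum (bigD1 k) //= coefZ coefXn eqxx mulr1.
rewrite big1 ?addr0 // => l lk; rewrite coefZ coefXn !eqSS.
case: eqP => e; rewrite ?mulr0 //.
by case/eqP: lk; apply: val_inj; rewrite /= e.
Qed.

Lemma coef01_invariants_poly (K : fieldType) (r : nat) (y : 'rV[K]_r) (i : nat) :
  (i < 2)%N -> (invariants_poly y)`_i = (i == 0%N)%:R.
Proof.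
move=> i2; rewrite coefD coef1 coef_sum big1 ?addr0 // => k _.
by rewrite coefZ coefXn; case: i i2 => [|[|i]] //= _; rewrite mulr0.
Qed.

(* With x_1, x_2, x_n and x_(n+1) kept equal to those of x0, the factor       *)
(* exp (- s3_arg) is a constant power series, so that the invariants depend   *)
(* on the remaining coordinates by an invertible affine map.                  *)
Definition point_of_invariants (R : realType) (n r : nat) (a : nat -> cplx R)
    (L : cplx R -> cplx R) (x0 : 'rV[cplx R]_n.+1) (y : 'rV[cplx R]_r) :
    'rV[cplx R]_n.+1 :=
  \row_i if (i < n.-1)%N then crd x0 1 *
      (exp_trunc n.-1 (s3_arg a L x0) * invariants_poly y)`_i
    else x0 0 i.

Lemma crd_point_of_invariants (R : realType) (n r : nat) (a : nat -> cplx R)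
    (L : cplx R -> cplx R) (x0 : 'rV[cplx R]_n.+1) (y : 'rV[cplx R]_r) :
  eq_upto n.-1 (crd_poly (point_of_invariants a L x0 y))
   (crd x0 1 *: (exp_trunc n.-1 (s3_arg a L x0) * invariants_poly y)).
Proof.
move=> i hi; rewrite coef_crd_poly // mxE inordK; last by lia.
by rewrite hi coefZ.
Qed.

(** The coefficients 1 and 0 of [invariants_poly] give back x_1 and x_2 of [x0]. So [s3_arg] is the
    same at both points, and the two exponentials cancel. *)
Lemma s3_casimir_point_of_invariants (R : realType) (n : nat)
    (a : nat -> cplx R) (L : cplx R -> cplx R) (x0 : 'rV[cplx R]_n.+1)
    (y : 'rV[cplx R]_(n - 3)) (k : 'I_(n - 3)) :
  (4 <= n)%N -> crd x0 1 != 0 ->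
  s3_casimir a L (k + 3)%N (point_of_invariants a L x0 y) = y 0 k.
Proof.
move=> hn x1; set x := point_of_invariants a L x0 y; have hk := ltn_ord k.
have hx := @crd_point_of_invariants R n (n - 3) a L x0 y; rewrite -/x in hx.
have q0 := coef0_s3_arg a L x0.
have d0 : (0 < n.-1)%N by lia.
have d1 : (1 < n.-1)%N by lia.
have n1 : (1 < n)%N by lia.
have n2 : (2 < n)%N by lia.
have e1 : crd x 1 = crd x0 1.
  rewrite crd1_crd_poly // hx // coefZ coef0_exp_truncM //.
  by rewrite coef01_invariants_poly // mulr1.
have e2 : crd x 2 = crd x0 2.
  rewrite crd2_crd_poly // hx // coefZ coef1_exp_truncM //.
  rewrite !coef01_invariants_poly // mulr1 add0r coef1_s3_arg.
  by rewrite mulrCA divff // mulr1.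
have ex : s3_arg a L x = s3_arg a L x0 by rewrite /s3_arg e1 e2.
rewrite s3_casimirE ?e1 //; last by lia.
have kk : ((k + 3).-1 < n.-1)%N by lia.
rewrite ex (eq_upto_mul (@eq_upto_refl _ n.-1 _) hx kk) -scalerAr coefZ mulrA.
rewrite mulVf // mul1r.
have qN0 : (- s3_arg a L x0)`_0 = 0 by rewrite coefN q0 oppr0.
have := exp_trunc_cancel (invariants_poly y) qN0 kk; rewrite opprK => ->.
by rewrite addn3 coef_invariants_poly.
Qed.

(** The section passes through [x0], so the preimage of an open set containing [x0] is not empty. *)
Lemma point_of_invariants_s3_casimir (R : realType) (n : nat)
    (a : nat -> cplx R) (L : cplx R -> cplx R) (x0 : 'rV[cplx R]_n.+1) :
  (4 <= n)%N -> crd x0 1 != 0 ->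
  point_of_invariants a L x0 (\row_(k < n - 3) s3_casimir a L (k + 3)%N x0) = x0.
Proof.
move=> hn x1; apply/rowP => i; rewrite mxE; case: ifP => // hi.
have q0 := coef0_s3_arg a L x0.
have qN0 : (- s3_arg a L x0)`_0 = 0 by rewrite coefN q0 oppr0.
have d0 : (0 < n.-1)%N by lia.
have d1 : (1 < n.-1)%N by lia.
have n1 : (1 < n)%N by lia.
have n2 : (2 < n)%N by lia.
set y := \row_k _.
have hY : eq_upto n.-1 (invariants_poly y)
    ((crd x0 1)^-1 *: (exp_trunc n.-1 (- s3_arg a L x0) * crd_poly x0)).
  move=> j hj; rewrite coefZ; case: j hj => [|[|j]] hj.
  - rewrite coef01_invariants_poly // coef0_exp_truncM // -crd1_crd_poly //.
    by rewrite mulVf.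
  - rewrite coef01_invariants_poly // coef1_exp_truncM // -crd1_crd_poly //.
    rewrite -crd2_crd_poly // coefN coef1_s3_arg mulNr divfK //.
    by rewrite subrr mulr0.
  have hj3 : (j < n - 3)%N by lia.
  rewrite -[j in LHS]/(nat_of_ord (Ordinal hj3)) coef_invariants_poly mxE /=.
  by rewrite s3_casimirE // ?addn3 //; lia.
rewrite (eq_upto_mul (@eq_upto_refl _ n.-1 _) hY hi) -scalerAr coefZ.
rewrite mulrA divff // mul1r exp_trunc_cancel // coef_crd_poly //.
by rewrite inord_val.
Qed.

Lemma point_of_invariants_continuous (R : realType) (n r : nat)
    (a : nat -> cplx R) (L : cplx R -> cplx R) (x0 : 'rV[cplx R]_n.+1) :
  continuous (@point_of_invariants R n r a L x0).
Proof.
move=> y; apply: (@cvg_mx _ _ _ _ _ (nbhs_filter y)) => i j; rewrite mxE.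
under eq_fun do rewrite mxE.
case: ifP => _; last exact: cvg_cst.
have E z : (exp_trunc n.-1 (s3_arg a L x0) * invariants_poly z)`_j =
    (exp_trunc n.-1 (s3_arg a L x0))`_j + \sum_(k < r) z 0 k *
    (exp_trunc n.-1 (s3_arg a L x0) * 'X^(k.+2))`_j.
  rewrite /invariants_poly mulrDr mulr1 coefD mulr_sumr.
  congr (_ + _); rewrite coef_sum.
  by apply: eq_bigr => k _; rewrite -scalerAr coefZ.
under eq_fun do rewrite E.
rewrite E; apply: (cvgM (cvg_cst _)); apply: (cvgD (cvg_cst _)).
apply: cvg_finite_sum => k.
exact: (cvgM (@coord_continuous _ _ _ 0 k y) (cvg_cst _)).
Qed.

(** Every [y] in the preimage of [V] under the section is the tuple of invariants of a point of [V];
    hence [Phi] vanishes on this nonempty open set. *)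
Lemma s3_functionally_independent (R : realType) (n : nat) (a : nat -> cplx R)
    (D : set (cplx R)) (L : cplx R -> cplx R) :
  (4 <= n)%N -> log_branch D L ->
  functionally_independent [set x : 'rV[cplx R]_n.+1 | D (crd x 1)]
    (fun k : 'I_(n - 3) => s3_casimir a L (k + 3)%N).
Proof.
move=> hn LB V oV [x0 Vx0] VU Phi _ hPhi.
have x1 := log_branch_neq0 LB (VU _ Vx0).
exists (point_of_invariants a L x0 @^-1` V); split.
- by apply: open_comp oV => y _; apply: point_of_invariants_continuous.
- exists (\row_k s3_casimir a L (k + 3)%N x0).
  by rewrite /preimage /= point_of_invariants_s3_casimir.
move=> y /hPhi <-; congr Phi; apply/rowP => k.
by rewrite mxE s3_casimir_point_of_invariants.
Qed.

Theorem mainTheorem9 (R : realType) (n : nat) (a : nat -> cplx R)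
    (hn : (4 <= n)%N)
    (ha : exists2 s : nat, (3 <= s <= n.-1)%N & a s != 0) :
  num_invariants (s3 n a) = (n - 3)%N /\
  forall (D : set (cplx R)) (L : cplx R -> cplx R), log_branch D L ->
    invariant_basis (s3 n a) [set x | D (crd x 1)]
      (fun k : 'I_(n - 3) => s3_casimir a L (k + 3)%N).
Proof.
split; first exact: s3_num_invariants.
move=> D L LB; split.
- by rewrite s3_num_invariants.
- move=> k; apply: s3_coadjoint_invariant LB; have := ltn_ord k; lia.
- exact: s3_functionally_independent.
Qed.
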